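(* Let $\mathbf{X}$ be an $\mathbb{R}^d$-valued càdlàg process and define the $(\mathcal{D}^{d\times d},\delta)$-valued random variables $\mathbf{q}_n(t)=\sum_{i:\,t^n_i\le t}(\mathbf{X}(t^n_{i+1})-\mathbf{X}(t^n_i))(\mathbf{X}(t^n_{i+1})-\mathbf{X}(t^n_i))^T$. Then the following are equivalent: (i) $\mathbf{X}$ is a process with finite quadratic variation; (ii) $(\mathbf{q}_n)$ converges in probability (in $(\mathcal D^{d\times d},\delta)$); (iii) $(\mathbf{q}_n)$ is a Cauchy sequence in probability (in $(\mathcal D^{d\times d},\delta)$). In addition: (iv) if $(\mathbf{q}_n)$ converges in probability, the limit is $[\mathbf{X}]$; (v) the convergence of $(\mathbf{q}_n)$ to $[\mathbf{X}]$ is uniform on compacts in probability (UCP) if and only if $\mathbf{X}$ is a continuous process with finite quadratic variation $[\mathbf{X}]$; (vi) $(\mathbf{q}_n)$ converges (resp. is a Cauchy sequence) in probability if and only if each component sequence $(\mathbf{q}_n^{jk})_n$ converges (resp. is a Cauchy sequence) in probability in $(\mathcal D,\delta)$.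
   Context: Let $\pi=(\pi_n)_{n\ge1}$ be a (deterministic) sequence of partitions $\pi_n=(t^n_0,\dots,t^n_{k_n})$ with $0=t^n_0<\dots<t^n_{k_n}<\infty$, $t^n_{k_n}\uparrow\infty$, and mesh tending to $0$ on compacts; sums over $i$ run over $0\le i<k_n$. $\mathcal{D}$ and $\mathcal D^{d\times d}$ denote the spaces of càdlàg functions $[0,\infty)\to\mathbb{R}$, resp. $\mathbb{R}^{d\times d}$, each equipped with a complete metric $\delta$ inducing the Skorokhod $J_1$ topology. A càdlàg process $\mathbf{X}$ is a process with finite quadratic variation (along $\pi$) if for every $t\ge0$, $\mathbf{q}_n(t)$ converges in probability to $[\mathbf{X}](t)$, where $[\mathbf{X}]$ is an increasing (in the positive semidefinite order) process with decomposition $[\mathbf{X}](t)=[\mathbf{X}]^c(t)+\sum_{s\le t}\Delta\mathbf{X}(s)\Delta\mathbf{X}(s)^T$, $[\mathbf{X}]^c$ continuous, and $\Delta\mathbf X(s)=\mathbf X(s)-\mathbf X(s-)$. $[\mathbf X]$ is called the quadratic variation of $\mathbf X$. *)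

(* Defs.v *)
From HB Require Import structures.
From mathcomp Require Import all_boot all_order all_algebra.
From mathcomp Require Import all_classical all_reals all_analysis.
Set Implicit Arguments. Unset Strict Implicit. Unset Printing Implicit Defensive.
Import Order.TTheory GRing.Theory Num.Theory.
Import numFieldNormedType.Exports.
Local Open Scope classical_set_scope.
Local Open Scope ring_scope.

Section Defs.
Variable R : realType.

(* pi_n = (tt n 0, ..., tt n (k n)); sums over i run over 0 <= i < k n. *)
Definition partition_seq (k : nat -> nat) (tt : nat -> nat -> R) : Prop :=
  [/\ (forall n, tt n 0%N = 0),
      (forall n i, (i < k n)%N -> tt n i < tt n i.+1),
      (forall n, tt n (k n) <= tt n.+1 (k n.+1)),
      (forall M : R, exists n, M < tt n (k n)) &
      (forall T eps : R, 0 < eps -> exists N, forall n, (N <= n)%N ->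
         forall i, (i < k n)%N -> tt n i <= T -> tt n i.+1 - tt n i < eps)].

Definition cadlagR (g : R -> R) : Prop :=
  (forall t, 0 <= t -> g @ t^'+ --> g t) /\
  (forall t, 0 < t -> cvg (g @ t^'-)).

Definition cadlag_mx (m n : nat) (f : R -> 'M[R]_(m, n)) : Prop :=
  forall i j, cadlagR (fun t => f t i j).

Definition jumpR (g : R -> R) (s : R) : R := g s - lim (g @ s^'-).

(** * Skorokhod J1 convergence (Ethier-Kurtz, Prop. 3.5.3) *)
Definition time_change (lam : R -> R) : Prop :=
  [/\ lam 0 = 0,
      {within `[0, +oo[, continuous lam},
      (forall s t, 0 <= s -> s < t -> lam s < lam t) &
      (forall u, 0 <= u -> exists t, 0 <= t /\ lam t = u)].

Definition J1conv (V : Type) (dist : V -> V -> R)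
    (xs : nat -> R -> V) (x : R -> V) : Prop :=
  exists lam : nat -> R -> R, (forall n, time_change (lam n)) /\
    forall T eps : R, 0 < eps -> exists N, forall n, (N <= n)%N ->
      forall t, 0 <= t <= T ->
        `|lam n t - t| <= eps /\ dist (xs n (lam n t)) (x t) <= eps.

Definition J1_metric (V : Type) (cad : (R -> V) -> Prop) (dist : V -> V -> R)
    (delta : (R -> V) -> (R -> V) -> R) : Prop :=
  [/\ (forall f g, cad f -> cad g -> 0 <= delta f g) /\
      (forall f g, cad f -> cad g -> (delta f g = 0 <-> forall t, 0 <= t -> f t = g t)),
      (forall f g, cad f -> cad g -> delta f g = delta g f),
      (forall f g h, cad f -> cad g -> cad h -> delta f h <= delta f g + delta g h),
      (forall fs : nat -> R -> V, (forall n, cad (fs n)) ->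
         (forall eps : R, 0 < eps -> exists N, forall m n, (N <= m)%N -> (N <= n)%N ->
            delta (fs m) (fs n) < eps) ->
         exists f, cad f /\ forall eps : R, 0 < eps -> exists N, forall n, (N <= n)%N ->
            delta (fs n) f < eps) &
      (forall fs f, (forall n, cad (fs n)) -> cad f ->
         ((forall eps : R, 0 < eps -> exists N, forall n, (N <= n)%N -> delta (fs n) f < eps)
          <-> J1conv dist fs f))].

Definition distR (a b : R) : R := `|a - b|.
Definition dist_mx (m n : nat) (A B : 'M[R]_(m, n)) : R :=
  \sum_(i < m) \sum_(j < n) `|A i j - B i j|.

Section Prob.
Context (dsp : measure_display) (Om : measurableType dsp) (P : probability Om R).

Definition Plt (A : set Om) (eta : R) : Prop := (P A < eta%:E)%E.

Definition rv_D (V : Type) (cad : (R -> V) -> Prop) (meas : (Om -> V) -> Prop)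
    (Y : Om -> R -> V) : Prop :=
  (forall w, cad (Y w)) /\ (forall t, meas (fun w => Y w t)).

Definition measR (Z : Om -> R) : Prop := measurable_fun setT Z.
Definition meas_mx (m n : nat) (Z : Om -> 'M[R]_(m, n)) : Prop :=
  forall i j, measurable_fun setT (fun w => Z w i j).

Definition conv_prob (V : Type) (delta : (R -> V) -> (R -> V) -> R)
    (Ys : nat -> Om -> R -> V) (Y : Om -> R -> V) : Prop :=
  forall eps eta : R, 0 < eps -> 0 < eta -> exists N, forall n, (N <= n)%N ->
    Plt [set w | eps < delta (Ys n w) (Y w)] eta.

Definition converges_prob (V : Type) (cad : (R -> V) -> Prop)
    (meas : (Om -> V) -> Prop) (delta : (R -> V) -> (R -> V) -> R)
    (Ys : nat -> Om -> R -> V) : Prop :=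
  exists Y, rv_D cad meas Y /\ conv_prob delta Ys Y.

Definition cauchy_prob (V : Type) (delta : (R -> V) -> (R -> V) -> R)
    (Ys : nat -> Om -> R -> V) : Prop :=
  forall eps eta : R, 0 < eps -> 0 < eta -> exists N, forall m n,
    (N <= m)%N -> (N <= n)%N ->
    Plt [set w | eps < delta (Ys n w) (Ys m w)] eta.

Definition ucp (m n : nat) (Ys : nat -> Om -> R -> 'M[R]_(m, n))
    (Y : Om -> R -> 'M[R]_(m, n)) : Prop :=
  forall T eps eta : R, 0 < T -> 0 < eps -> 0 < eta -> exists N, forall p, (N <= p)%N ->
    Plt [set w | exists t, 0 <= t <= T /\
                 exists i j, eps < `|Ys p w t i j - Y w t i j| ] eta.

Variable d : nat.

Definition qv_seq (X : Om -> R -> 'cV[R]_d) (k : nat -> nat)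
    (tt : nat -> nat -> R) (n : nat) (w : Om) (t : R) : 'M[R]_d :=
  \sum_(i < k n | tt n i <= t)
     ((X w (tt n i.+1) - X w (tt n i)) *m (X w (tt n i.+1) - X w (tt n i))^T).

Definition psd (A : 'M[R]_d) : Prop :=
  forall v : 'cV[R]_d, 0 <= (v^T *m A *m v) 0 0.

Definition has_sum (f : R -> R) (A : set R) (v : R) : Prop :=
  forall eps : R, 0 < eps -> exists l0 : seq R, (forall s, s \in l0 -> A s) /\
    forall l : seq R, uniq l -> (forall s, s \in l -> A s) ->
      (forall s, s \in l0 -> s \in l) -> `|\sum_(s <- l) f s - v| < eps.

Definition is_qv (X : Om -> R -> 'cV[R]_d) (k : nat -> nat) (tt : nat -> nat -> R)
    (Q : Om -> R -> 'M[R]_d) : Prop :=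
  [/\ (forall t, meas_mx (fun w => Q w t)),
      (forall t, 0 <= t -> forall i j (eps eta : R), 0 < eps -> 0 < eta ->
         exists N, forall n, (N <= n)%N ->
           Plt [set w | eps < `|qv_seq X k tt n w t i j - Q w t i j| ] eta) &
      {ae P, forall w,
        (forall s t, 0 <= s -> s <= t -> psd (Q w t - Q w s)) /\
        exists Qc : R -> 'M[R]_d,
          (forall i j, {within `[0, +oo[, continuous (fun t => Qc t i j)}) /\
          (forall t, 0 <= t -> forall i j,
             has_sum (fun s => jumpR (fun u => X w u i 0) s * jumpR (fun u => X w u j 0) s)
                     `]0, t] (Q w t i j - Qc t i j))}].

Definition finite_qv (X : Om -> R -> 'cV[R]_d) (k : nat -> nat) (tt : nat -> nat -> R) :=
  exists Q, is_qv X k tt Q.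

Definition as_continuous (X : Om -> R -> 'cV[R]_d) : Prop :=
  {ae P, forall w, forall i, {within `[0, +oo[, continuous (fun t => X w t i 0)}}.

End Prob.
End Defs.

(* Main.v *)
Require Import Defs.
From HB Require Import structures.
From mathcomp Require Import all_boot all_order all_algebra.
From mathcomp Require Import all_classical all_reals all_analysis.
From mathcomp Require Import measurable_realfun.
From mathcomp Require Import ring lra zify.
Import Order.TTheory GRing.Theory Num.Theory.
Import numFieldNormedType.Exports.
Local Open Scope classical_set_scope.
Local Open Scope ring_scope.

(** Everything reduces to two deterministic facts about the sums [q_n] of products of increments
    of càdlàg paths along partitions of vanishing mesh.
    (A) If [q_n -> Y] in J1, then [q_n(t) -> Y(t)] for every [t], and the jump of [Y] at [t] is the
    product of the jumps of the paths: near [t] the only jump of [q_n] that does not vanish is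
    carried by the last partition point before [t], and the time changes must match it with the
    jump of [Y] at [t].
    (B) Conversely, if [Y] is càdlàg with these jumps and [q_n -> Y] at the rational times, then
    [q_n -> Y] in J1, jointly for all entries: by polarization one may take squares of increments,
    whose sums are monotone, and use the time changes that send finitely many points [s_l] to the
    partition points whose increments straddle them.
    By (A) a J1 limit of [q_n] is increasing with summable jumps, hence is the quadratic variation;
    (A) and (B) together pass between matrices and entries. Convergence in probability is handled
    by almost sure convergence along subsequences. This requires the events
    [{eps < delta(Y, Z)}] to be measurable, which follows by discretizing the paths. *)

Set Implicit Arguments. Unset Strict Implicit. Unset Printing Implicit Defensive.

(** * One-sided limits and jumps *)

Section RealPaths.
Variable R : realType.
Implicit Types (g h x y : R -> R) (s t l : R).

(** Two features of J1 shape the argument. First, addition is not continuous in J1, and each entry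
    may come with its own time changes, so entrywise convergence cannot be assembled directly. It
    has to pass through data that ignore time changes: values at fixed times and jumps. Second,
    [q_n] counts a whole increment from the left end of its interval on, so a jump of the path at
    [s] enters [q_n] strictly before [s]. The time change has to undo this advance; uniform
    convergence leaves no room for that, hence the link with continuity in (v). Convergence in
    probability at each fixed time gives almost sure convergence along one subsequence for countably
    many times at once, which is why (B) starts from rational times; monotonicity of sums of squares
    fills the gaps between them. The metric is arbitrary among those inducing J1, so measurability
    cannot be read off a formula for it. It is obtained by approximating paths with members of a
    countable family, on which any function of the code is measurable. *)

Definition rcont g t := forall e : R, 0 < e ->
  exists2 d : R, 0 < d & forall s, t <= s -> s < t + d -> `|g s - g t| < e.

Definition llim g t l := forall e : R, 0 < e ->
  exists2 d : R, 0 < d & forall s, t - d < s -> s < t -> `|g s - l| < e.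

Lemma rcontP g t : g @ t^'+ --> g t <-> rcont g t.
Proof.
split=> [/cvgrPdist_lt H e e0|H].
- have [d d0 Hd] := H e e0; exists d => // s ts std.
  have [<-|nst] := eqVneq t s; first by rewrite subrr normr0.
  rewrite distrC; apply: Hd => /=; last by rewrite lt_neqAle nst.
  by rewrite ltr0_norm; lra.
- apply/cvgrPdist_lt => e e0; have [d d0 Hd] := H e e0.
  exists d => //= s /= ds ts; rewrite distrC; apply: Hd; first exact: ltW.
  by move: ds; rewrite ltr_norml; lra.
Qed.

Lemma llimP g t l : g @ t^'- --> l <-> llim g t l.
Proof.
split=> [/cvgrPdist_lt H e e0|H].
- have [d d0 Hd] := H e e0; exists d => // s ts std.
  rewrite distrC; apply: Hd => //=.
  by rewrite gtr0_norm; lra.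
- apply/cvgrPdist_lt => e e0; have [d d0 Hd] := H e e0.
  exists d => //= s /= ds ts; rewrite distrC; apply: Hd => //.
  by move: ds; rewrite ltr_norml; lra.
Qed.

Lemma llim_jump g t l : llim g t l -> jumpR g t = g t - l.
Proof. by move/llimP/cvg_lim; rewrite /jumpR => ->. Qed.

(** The left limit is written [g t - jumpR g t], so that later estimates involve only values and
    jumps and never [lim], whose value is arbitrary when no limit exists. *)
Lemma cadlagRP g : cadlagR g <->
  (forall t, 0 <= t -> rcont g t) /\ (forall t, 0 < t -> llim g t (g t - jumpR g t)).
Proof.
split=> -[H1 H2]; split=> t t0.
- exact/rcontP/H1.
- by apply/llimP; rewrite /jumpR opprB addrC subrK; apply: H2.
- exact/rcontP/H1.
- by have /llimP := H2 _ t0; apply: cvgP.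
Qed.

Lemma cadlag_from_llim g : (forall t, 0 <= t -> rcont g t) ->
  (forall t, 0 < t -> exists l, llim g t l) -> cadlagR g.
Proof.
move=> H1 H2; apply/cadlagRP; split=> // t t0.
by have [l Hl] := H2 t t0; rewrite (llim_jump Hl) opprB addrC subrK.
Qed.

Lemma rcontD g h t : rcont g t -> rcont h t -> rcont (fun u => g u + h u) t.
Proof. by move=> /rcontP A /rcontP B; apply/rcontP; apply: cvgD. Qed.

Lemma llimD g h t l m : llim g t l -> llim h t m -> llim (fun u => g u + h u) t (l + m).
Proof. by move=> /llimP A /llimP B; apply/llimP; apply: cvgD. Qed.

Lemma llimZ g a t l : llim g t l -> llim (fun u => a * g u) t (a * l).
Proof. by move=> /llimP A; apply/llimP; apply: cvgMr. Qed.

Lemma rcontZ g a t : rcont g t -> rcont (fun u => a * g u) t.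
Proof. by move=> /rcontP A; apply/rcontP; apply: cvgMr. Qed.

Lemma cadlagD g h : cadlagR g -> cadlagR h -> cadlagR (fun u => g u + h u).
Proof.
move=> /cadlagRP[A B] /cadlagRP[A' B']; apply: cadlag_from_llim => t t0.
- by apply: rcontD; [apply: A|apply: A'].
- by eexists; apply: llimD; [apply: B|apply: B'].
Qed.

Lemma cadlagZ g a : cadlagR g -> cadlagR (fun u => a * g u).
Proof.
move=> /cadlagRP[A B]; apply: cadlag_from_llim => t t0.
- by apply: rcontZ; apply: A.
- by eexists; apply: llimZ; apply: B.
Qed.

Lemma jumpD g h t : 0 < t -> cadlagR g -> cadlagR h ->
  jumpR (fun u => g u + h u) t = jumpR g t + jumpR h t.
Proof.
move=> t0 /cadlagRP[_ /(_ _ t0) A] /cadlagRP[_ /(_ _ t0) B].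
by rewrite (llim_jump (llimD A B)); ring.
Qed.

Lemma jumpZ g a t : 0 < t -> cadlagR g -> jumpR (fun u => a * g u) t = a * jumpR g t.
Proof.
by move=> t0 /cadlagRP[_ /(_ _ t0) A]; rewrite (llim_jump (llimZ a A)); ring.
Qed.

Lemma cadlag_cst (c : R) : cadlagR (fun=> c).
Proof.
apply: cadlag_from_llim => t _; last exists c; move=> e e0; exists 1 => //.
- by move=> *; rewrite subrr normr0.
- by move=> *; rewrite subrr normr0.
Qed.

Lemma cadlag_eq g h : (forall t, 0 <= t -> g t = h t) -> cadlagR g -> cadlagR h.
Proof.
move=> gh /cadlagRP[A B]; apply: cadlag_from_llim => t t0.
- move=> e e0; have [d d0 Hd] := A t t0 e e0; exists d => // s ts std.
  by rewrite -!gh//; [apply: Hd|lra].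
- exists (g t - jumpR g t) => e e0; have [d d0 Hd] := B t t0 e e0.
  have m1 : Num.min d t <= d by rewrite ge_min lexx.
  have m2 : Num.min d t <= t by rewrite ge_min lexx orbT.
  exists (Num.min d t); first by rewrite lt_min d0.
  by move=> s s1 s2; rewrite -(gh s); [apply: Hd => //; lra|lra].
Qed.

Lemma cadlag_continuous g : cadlagR g -> (forall t, 0 < t -> jumpR g t = 0) ->
  {within `[0, +oo[, continuous g}.
Proof.
move=> /cadlagRP[A B] J; apply/continuous_within_itvcyP; split; last exact/rcontP/A.
move=> t; rewrite in_itv/= andbT => t0; apply/left_right_continuousP; split.
- by apply/llimP; have := B _ t0; rewrite J// subr0.
- exact/rcontP/A/ltW.
Qed.

Lemma continuous_jump0 g t : {within `[0, +oo[, continuous g} -> 0 < t -> jumpR g t = 0.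
Proof.
move=> /continuous_within_itvcyP[C _] t0.
have /left_right_continuousP[L _] : {for t, continuous g}.
  by apply: C; rewrite in_itv/= t0.
by move/llimP/llim_jump: L => ->; rewrite subrr.
Qed.

Lemma continuous_cadlag g : {within `[0, +oo[, continuous g} -> cadlagR g.
Proof.
move=> /continuous_within_itvcyP[C C0]; split=> t t0.
- move: t0; rewrite le_eqVlt => /predU1P[<-//|t0].
  by have /left_right_continuousP[] : {for t, continuous g} by apply: C; rewrite in_itv/= t0.
- have /left_right_continuousP[L _] : {for t, continuous g} by apply: C; rewrite in_itv/= t0.
  exact: cvgP L.
Qed.
End RealPaths.

(** * Time changes and the J1 topology *)

Section TimeChanges.
Variable R : realType.

Lemma fin_eventually (A : finType) (Q : A -> nat -> Prop) :
  (forall a, exists N, forall n, (N <= n)%N -> Q a n) ->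
  exists N, forall n, (N <= n)%N -> forall a, Q a n.
Proof.
move=> /choice[N HN]; exists (\max_a N a)%N => n Hn a; apply: HN.
by apply: leq_trans Hn; apply: leq_bigmax.
Qed.

Lemma fin_small (A : finType) (Q : A -> R -> Prop) :
  (forall a d d', Q a d -> 0 < d' -> d' <= d -> Q a d') ->
  (forall a, exists2 d, 0 < d & Q a d) -> exists2 d, 0 < d & forall a, Q a d.
Proof.
move=> Qm H.
suff [d d0 Hd] : exists2 d, 0 < d & forall a, a \in enum A -> Q a d.
  by exists d => // a; apply: Hd; rewrite mem_enum.
elim: (enum A) => [|a s [d d0 IH]]; first by exists 1.
have [d' d'0 Hd'] := H a.
have m0 : 0 < Num.min d d' by rewrite lt_min d0.
exists (Num.min d d') => // b; rewrite inE => /predU1P[->|/IH bs].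
- by apply: Qm Hd' m0 _; rewrite ge_min lexx orbT.
- by apply: Qm bs m0 _; rewrite ge_min lexx.
Qed.

(** Continuity comes for free: a strictly increasing map that misses no value has no jump. *)
Lemma time_changeI (lam : R -> R) : lam 0 = 0 ->
  (forall s t, 0 <= s -> s < t -> lam s < lam t) ->
  (forall u, 0 <= u -> exists t, 0 <= t /\ lam t = u) -> time_change lam.
Proof.
move=> l0 mono surj; split=> //.
have lt_of s t : 0 <= s -> 0 <= t -> lam s < lam t -> s < t.
  move=> s0 t0 st; rewrite ltNge; apply/negP; rewrite le_eqVlt => /predU1P[E|/(mono _ _ t0)].
    by move: st; rewrite E ltxx.
  by move/(lt_trans st); rewrite ltxx.
have nn t : 0 <= t -> 0 <= lam t.
  rewrite le_eqVlt => /predU1P[<-|]; first by rewrite l0.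
  by move=> /(mono _ _ (lexx 0)); rewrite l0 => /ltW.
have rc t : 0 <= t -> rcont lam t.
  move=> t0 e e0; have [|t' [t'0 Et']] := surj (lam t + e); first by have := nn t t0; lra.
  have tt' : t < t' by apply: lt_of => //; lra.
  exists (t' - t); first lra.
  move=> s ts st; have : lam s < lam t' by apply: mono; lra.
  move: ts; rewrite le_eqVlt => /predU1P[<-|/(mono _ _ t0)]; first by rewrite subrr normr0.
  by move=> *; rewrite gtr0_norm; lra.
apply/continuous_within_itvcyP; split; last exact/rcontP/rc.
move=> t; rewrite in_itv/= andbT => t0; apply/left_right_continuousP; split;
  last exact/rcontP/rc/ltW.
apply/llimP => e e0; have lt0 := mono _ _ (lexx 0) t0; rewrite l0 in lt0.
(* The maximum with [lam t / 2] keeps the level nonnegative, hence attained, and still below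
   [lam t]. *)
have [|t' [t'0 Et']] := surj (Num.max (lam t - e) (lam t / 2)).
  by rewrite le_max; apply/orP; right; lra.
have u1 : lam t - e <= lam t' by rewrite Et' le_max lexx.
have u2 : lam t' < lam t by rewrite Et' gt_max; apply/andP; split; lra.
have tt' : t' < t by apply: lt_of => //; lra.
exists (t - t'); first lra.
move=> s ts st.
have A : lam t' < lam s by apply: mono; lra.
have B : lam s < lam t by apply: mono; lra.
by rewrite ltr0_norm; lra.
Qed.

Lemma time_change_id : time_change (@id R).
Proof. by apply: time_changeI => // u u0; exists u. Qed.

Definition incr_upto (r : nat) (s : nat -> R) := forall l, (l < r)%N -> s l < s l.+1.

Lemma incr_upto_le (r : nat) (s : nat -> R) l m : incr_upto r s -> (l <= m)%N -> (m <= r)%N -> s l <= s m.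
Proof.
move=> H; elim: m => [|m IH]; first by rewrite leqn0 => /eqP->.
rewrite leq_eqVlt => /predU1P[->//|lm mr].
by apply: le_trans (ltW (H m mr)); apply: IH => //; apply: ltnW.
Qed.

Lemma incr_upto_locate (r : nat) (s : nat -> R) t : s 0%N <= t -> t < s r ->
  exists2 l, (l < r)%N & s l <= t < s l.+1.
Proof.
elim: r => [|r IH] s0 tr; first by move: tr; rewrite ltNge s0.
case: (ltP t (s r)) => [/(IH s0)[l lr Hl]|rt]; first by exists l => //; apply: ltnW.
by exists r => //; rewrite rt.
Qed.

(** Piecewise linear interpolation through the points [(s l, sig l)], continued with slope one. On
    each piece [lam t - t] is a convex combination of the deviations at the two nodes, so the bound
    [eta] at the nodes is a bound everywhere. *)
Lemma time_change_interp (r : nat) (s sig : nat -> R) (eta : R) :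
  s 0%N = 0 -> sig 0%N = 0 -> incr_upto r s -> incr_upto r sig ->
  (forall l, (l <= r)%N -> `|sig l - s l| <= eta) ->
  exists lam, [/\ time_change lam, forall l, (l <= r)%N -> lam (s l) = sig l &
    forall t, 0 <= t -> `|lam t - t| <= eta].
Proof.
move=> s0 g0 si gi Heta.
suff [lam [[[A _ B C] D E] _]] : exists lam, [/\ time_change lam,
    forall l, (l <= r)%N -> lam (s l) = sig l &
    forall t, 0 <= t -> `|lam t - t| <= eta] /\
    forall t, s r <= t -> lam t = sig r + (t - s r).
  by exists lam; split => //; apply: time_changeI.
elim: r si gi Heta => [|r IH] si gi Heta.
  exists id; split; first split; [exact: time_change_id| | |].
  - by move=> l; rewrite leqn0 => /eqP->; rewrite s0 g0.
  - by move=> t _; rewrite subrr normr0; apply: le_trans (Heta 0%N _) => //.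
  - by move=> t _; rewrite s0 g0; lra.
have [l lr|l lr|l lr|lam [[[A _ B C] D E] F]] := IH.
- by apply: si; apply: ltnW.
- by apply: gi; apply: ltnW.
- by apply: Heta; apply: ltnW.
have sr0 : 0 <= s r by rewrite -s0; apply: (incr_upto_le si).
have gr0 : 0 <= sig r by rewrite -g0; apply: (incr_upto_le gi).
have sr := si r (ltnSn r); have gr := gi r (ltnSn r).
have lr : lam (s r) = sig r by apply: D.
set c := (sig r.+1 - sig r) / (s r.+1 - s r).
have c0 : 0 < c by rewrite divr_gt0// subr_gt0.
have cE : c * (s r.+1 - s r) = sig r.+1 - sig r by rewrite /c divfK// gt_eqF// subr_gt0.
pose mid t := sig r + c * (t - s r).
pose lam' t := if t <= s r then lam t else if t <= s r.+1 then mid t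
               else sig r.+1 + (t - s r.+1).
have midmono t t' : t < t' -> mid t < mid t'.
  by move=> tt'; rewrite /mid ltrD2l ltr_pM2l//; lra.
have mid1 : mid (s r) = sig r by rewrite /mid subrr mulr0 addr0.
have mid2 : mid (s r.+1) = sig r.+1 by rewrite /mid cE; lra.
exists lam'; split; first split.
- apply: time_changeI.
  + by rewrite /lam' sr0.
  + move=> t t' t0 tt'; rewrite /lam'.
    case: (leP t (s r)) => tr; case: (leP t' (s r)) => t'r; try lra; first exact: B.
    * have : lam t <= sig r.
        by move: tr; rewrite le_eqVlt -lr => /predU1P[->//|/(B _ _ t0)/ltW].
      by case: (leP t' (s r.+1)) => ?; [have := midmono _ _ t'r; lra|lra].
    * case: (leP t (s r.+1)) => tr'; case: (leP t' (s r.+1)) => t'r'; try lra.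
      - exact: midmono.
      - have : mid t <= sig r.+1.
          by move: tr'; rewrite le_eqVlt -mid2 => /predU1P[->//|/midmono/ltW].
        lra.
  + move=> u u0; rewrite /lam'; case: (leP u (sig r)) => ur.
      have [t [t0 tu]] := C u u0; exists t; split => //; case: (leP t (s r)) => //.
      by move=> /(B _ _ sr0); rewrite lr; lra.
    case: (leP u (sig r.+1)) => ur'.
      exists (s r + (u - sig r) / c).
      have p0 : 0 < (u - sig r) / c by rewrite divr_gt0// subr_gt0.
      have p1 : (u - sig r) / c <= s r.+1 - s r.
        by rewrite ler_pdivrMr// mulrC cE; lra.
      split; first lra.
      rewrite ifF; last by apply/negbTE; rewrite -ltNge; lra.
      rewrite ifT; last lra.
      rewrite /mid [X in c * X](_ : _ = (u - sig r) / c); last ring.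
      by rewrite mulrC divfK ?gt_eqF//; lra.
    exists (s r.+1 + (u - sig r.+1)); split; first lra.
    rewrite ifF; last by apply/negbTE; rewrite -ltNge; lra.
    rewrite ifF; last by apply/negbTE; rewrite -ltNge; lra.
    lra.
- move=> l; rewrite leq_eqVlt => /predU1P[->|lr'].
    by rewrite /lam' lexx ifF ?mid2//; apply/negbTE; rewrite -ltNge.
  rewrite /lam' ifT; first exact: D.
  exact: (incr_upto_le si).
- move=> t t0; rewrite /lam'; case: (leP t (s r)) => tr; first exact: E.
  have := Heta r (leqnSn r); have := Heta r.+1 (leqnn _).
  rewrite !ler_norml => /andP[a1 a2] /andP[a3 a4].
  case: (leP t (s r.+1)) => tr'; last by apply/andP; split; lra.
  set th := (t - s r) / (s r.+1 - s r).
  have D0 : 0 < s r.+1 - s r by lra.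
  have th0 : 0 <= th by rewrite divr_ge0//; lra.
  have th1 : th <= 1 by rewrite ler_pdivrMr// mul1r; lra.
  have tE : t = s r + th * (s r.+1 - s r) by rewrite /th divfK ?gt_eqF//; lra.
  have mE : mid t = sig r + th * (sig r.+1 - sig r).
    by rewrite /mid -cE {1}tE; ring.
  have -> : mid t - t = (1 - th) * (sig r - s r) + th * (sig r.+1 - s r.+1).
    by rewrite mE; apply: (@addrI _ t); rewrite addrCA subrr addr0 [in RHS]tE; ring.
  clear -th0 th1 a1 a2 a3 a4.
  apply/andP; split; nra.
- move=> t tr; rewrite /lam' ifF; last by apply/negbTE; rewrite -ltNge; lra.
  case: leP => // tr'; have -> : t = s r.+1 by lra.
  by rewrite mid2; lra.
Qed.

(** [J1conv] asks for one sequence of time changes that serves every [T] and [eps]. A diagonal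
    choice allows them to depend on [T] and [eps]. *)
Lemma J1convI (V : Type) (dist : V -> V -> R) (xs : nat -> R -> V) (x : R -> V) :
  (forall T eps : R, 0 < eps -> exists N, forall n, (N <= n)%N ->
     exists2 lam, time_change lam & forall t, 0 <= t <= T ->
        `|lam t - t| <= eps /\ dist (xs n (lam t)) (x t) <= eps) ->
  J1conv dist xs x.
Proof.
move=> H.
pose good m n lam := time_change lam /\ forall t, 0 <= t <= m%:R ->
  `|lam t - t| <= m.+1%:R^-1 :> R /\ dist (xs n (lam t)) (x t) <= m.+1%:R^-1.
have /choice[N HN] m : exists N, forall n, (N <= n)%N -> exists lam, good m n lam.
  have [|N HN] := H m%:R (m.+1%:R^-1); first by rewrite invr_gt0.
  by exists N => n /HN[lam L1 L2]; exists lam.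
(* The bound [m <= n] ensures that a largest [m] exists. The thresholds tested are [N 1] to [N m];
   [N 0] is treated apart, with the identity as default below it. *)
pose best n m := (m <= n)%N && [forall l : 'I_m, (N l.+1 <= n)%N].
(* lam n is the time change of the largest admissible precision m *)
have /choice[lam Hlam] n : exists lam, time_change lam /\
    forall m, (N m <= n)%N -> (m <= n)%N ->
    (forall l, (l <= m)%N -> (N l <= n)%N) -> exists2 m', (m <= m')%N & good m' n lam.
  case: (leqP (N 0%N) n) => N0; last first.
    exists id; split; first exact: time_change_id.
    by move=> m _ _ /(_ 0%N (leq0n _)); rewrite leqNgt N0.
  have b0 : exists m, best n m by exists 0%N; apply/andP; split=> //; apply/forallP => -[].
  have bu m : best n m -> (m <= n)%N by case/andP.
  case: (ex_maxnP b0 bu) => m /andP[mn /forallP bm] mmax.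
  have Nm : (N m <= n)%N.
    by case: m mn bm {mmax} => // m mn bm; apply: (bm ord_max).
  have [lam L] := HN m n Nm; exists lam; split; first by case: L.
  move=> m' _ m'n Hm'; exists m => //; apply: mmax; apply/andP; split => //.
  by apply/forallP => l; apply: Hm'.
exists lam; split=> [n|T eps e0]; first by case: (Hlam n).
pose m := maxn (Num.truncn `|T|).+1 (Num.truncn eps^-1).+1.
exists (maxn m (\max_(l < m.+1) N l))%N => n; rewrite geq_max => /andP[mn Nn] t /andP[t0 tT].
have Nl l : (l <= m)%N -> (N l <= n)%N.
  by move=> lm; apply: leq_trans Nn; apply: (leq_bigmax (Ordinal (lm : (l < m.+1)%N))).
have [_ /(_ m (Nl _ (leqnn _)) mn Nl)[m' mm' [_ Hm']]] := Hlam n.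
have Tm : T <= m'%:R.
  apply: le_trans (ler_norm _) _; apply: le_trans (ltW (truncnS_gt _)) _.
  by rewrite ler_nat; apply: leq_trans mm'; apply: leq_maxl.
have em : m'.+1%:R^-1 <= eps.
  rewrite invf_ple ?posrE//; apply: le_trans (ltW (truncnS_gt _)) _.
  by rewrite ler_nat; apply: leq_trans (leqnSn _); apply: leq_trans mm'; apply: leq_maxr.
have [|A B] := Hm' t; first by rewrite t0 (le_trans tT).
by split; [apply: le_trans A em|apply: le_trans B em].
Qed.

(** Let [E] be the set of end points that such a subdivision can reach. Right continuity pushes any
    reachable point further, and left limits make the supremum of [E] reachable; so [E] cannot be
    bounded by [T]. *)
Lemma cadlag_partition (A : finType) (y : A -> R -> R) (T eps : R) :
  (forall a, cadlagR (y a)) -> 0 < eps ->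
  exists r s, [/\ s 0%N = 0, incr_upto r s, T < s r &
    forall l, (l < r)%N -> forall a t t', s l <= t < s l.+1 -> s l <= t' < s l.+1 ->
      `|y a t - y a t'| <= eps].
Proof.
move=> cad e0.
pose E tau := exists r s, [/\ s 0%N = 0, incr_upto r s, s r = tau &
    forall l, (l < r)%N -> forall a t t', s l <= t < s l.+1 -> s l <= t' < s l.+1 ->
      `|y a t - y a t'| <= eps].
have Eext tau tau' : E tau -> tau < tau' ->
    (forall a t t', tau <= t < tau' -> tau <= t' < tau' -> `|y a t - y a t'| <= eps) -> E tau'.
  move=> [r [s [s0 si sr so]]] tt' Ho.
  exists r.+1, (fun l => if (l <= r)%N then s l else tau'); split=> //.
  - move=> l lr1; have [->|lr] : l = r \/ (l < r)%N by lia.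
      by rewrite /= leqnn ltnn sr.
    by rewrite /= (ltnW lr) lr; apply: si.
  - by rewrite /= ltnn.
  - move=> l lr1 a t t'; have [->|lr] : l = r \/ (l < r)%N by lia.
      by rewrite /= leqnn ltnn sr; apply: Ho.
    by rewrite /= (ltnW lr) lr; apply: so.
have Er tau : 0 <= tau -> E tau -> exists2 d, 0 < d & E (tau + d).
  move=> tau0 Et.
  have [|a|d d0 Hd] := @fin_small A (fun a d => forall s, tau <= s -> s < tau + d ->
      `|y a s - y a tau| < eps / 2).
  - by move=> a d d' H d'0 d'd s ts sd; apply: H => //; lra.
  - by have /cadlagRP[/(_ _ tau0) B _] := cad a; apply: B; lra.
  exists d => //; apply: Eext Et _ _; first lra.
  move=> a t t' /andP[t1 t2] /andP[t3 t4].
  have := Hd a _ t1 t2; have := Hd a _ t3 t4; rewrite !ltr_norml ler_norml => /andP[? ?] /andP[? ?].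
  by apply/andP; split; lra.
have E0 : E 0 by exists 0%N, (fun=> 0).
have Ege tau : E tau -> 0 <= tau.
  by move=> [r [s [s0 si <- _]]]; rewrite -s0; apply: (incr_upto_le si).
apply: contrapT => H.
have ubE : ubound E T.
  move=> tau [r [s [s0 si sr so]]]; rewrite leNgt; apply/negP => Tt; apply: H.
  by exists r, s; split => //; rewrite sr.
have hs : has_sup E by split; [exists 0|exists T].
have c0 : 0 < sup E.
  have [d d0 Ed] := Er 0 (lexx _) E0; rewrite add0r in Ed.
  by apply: lt_le_trans d0 _; apply: ub_le_sup => //; exists T.
have Ec : E (sup E).
  have [|a|d d0 Hd] := @fin_small A (fun a d => forall s, sup E - d < s -> s < sup E ->
      `|y a s - (y a (sup E) - jumpR (y a) (sup E))| < eps / 2).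
  - by move=> a d d' K d'0 d'd s ts sd; apply: K => //; lra.
  - by have /cadlagRP[_ /(_ _ c0) B] := cad a; apply: B; lra.
  have [tau Et td] := sup_adherent d0 hs.
  have := ub_le_sup (ex_intro _ T ubE) Et; rewrite le_eqVlt => /predU1P[<-//|tE].
  apply: Eext Et tE _ => a t t' /andP[t1 t2] /andP[t3 t4].
  have := Hd a t (lt_le_trans td t1) t2; have := Hd a t' (lt_le_trans td t3) t4.
  rewrite !ltr_norml ler_norml => /andP[? ?] /andP[? ?].
  by apply/andP; split; lra.
have [d d0 Ed] := Er _ (ltW c0) Ec.
by have := ub_le_sup (ex_intro _ T ubE) Ed; lra.
Qed.
End TimeChanges.

(** * Limits of quadratic covariations *)

Section QuadraticCovariation.
Variable R : realType.
Implicit Types (x y Y : R -> R) (k : nat -> nat) (tt : nat -> nat -> R).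

(** The growth of the last point is put in eventual form, which passes to subsequences at once. *)
Definition fine_part k tt : Prop :=
  [/\ (forall n, tt n 0%N = 0),
      (forall n, incr_upto (k n) (tt n)),
      (forall M : R, exists N, forall n, (N <= n)%N -> M < tt n (k n)) &
      (forall T eps : R, 0 < eps -> exists N, forall n, (N <= n)%N ->
         forall i, (i < k n)%N -> tt n i <= T -> tt n i.+1 - tt n i < eps)].

Lemma fine_partition k tt : partition_seq k tt -> fine_part k tt.
Proof.
case=> A B C D E; split=> // M; have [N HN] := D M; exists N => n.
elim: n => [|n IH]; first by rewrite leqn0 => /eqP <-.
by rewrite leq_eqVlt => /predU1P[<-//|/IH H]; apply: lt_le_trans H (C n).
Qed.

Lemma subseq_ge (phi : nat -> nat) : {homo phi : m n / (m < n)%N} -> forall n, (n <= phi n)%N.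
Proof. by move=> H; elim=> // n IH; apply: leq_ltn_trans IH (H _ _ _). Qed.

Lemma fine_part_subseq k tt phi : {homo phi : m n / (m < n)%N} ->
  fine_part k tt -> fine_part (k \o phi) (tt \o phi).
Proof.
move=> /subseq_ge phi_ge [A B C D]; split.
- by move=> n; apply: A.
- by move=> n; apply: B.
- by move=> M; have [N HN] := C M; exists N => n Nn; apply/HN/(leq_trans Nn).
- move=> T e e0; have [N HN] := D T e e0; exists N => n Nn.
  exact/HN/(leq_trans Nn).
Qed.

Definition incp tt x y n i := (x (tt n i.+1) - x (tt n i)) * (y (tt n i.+1) - y (tt n i)).

Definition qcov k tt x y n (t : R) := \sum_(i < k n | tt n i <= t) incp tt x y n i.

Lemma incr_upto_lt (r : nat) (s : nat -> R) l m : incr_upto r s ->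
  (l < m)%N -> (m <= r)%N -> s l < s m.
Proof.
move=> H lm mr; apply: lt_le_trans (H l (leq_trans lm mr)) _.
exact: (incr_upto_le H).
Qed.

Lemma incr_upto_locateL (r : nat) (s : nat -> R) t : s 0%N < t -> t <= s r ->
  exists2 l, (l < r)%N & s l < t <= s l.+1.
Proof.
elim: r => [|r IH] s0 tr; first by move: tr; rewrite leNgt s0.
case: (leP t (s r)) => [/(IH s0)[l lr Hl]|rt]; first by exists l => //; apply: ltnW.
by exists r => //; rewrite rt.
Qed.

Lemma ltn_of_incr (r : nat) (s : nat -> R) l m : incr_upto r s ->
  (l <= r)%N -> s l < s m -> (l < m)%N.
Proof.
move=> H lr sl; rewrite ltnNge; apply/negP => ml.
by have := incr_upto_le H ml lr; rewrite leNgt sl.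
Qed.

(** [qcov] is a step function: [eta] separates [p] from the partition points below it. The exact
    equality on a left neighbourhood lets jumps be compared at a single nearby point, without
    limits. *)
Lemma qcov_left k tt x y n (p : R) : exists2 eta, 0 < eta & forall u, p - eta <= u -> u < p ->
  qcov k tt x y n p - qcov k tt x y n u = \sum_(i < k n | tt n i == p) incp tt x y n i.
Proof.
have [|i|eta e0 He] := @fin_small R 'I_(k n) (fun i d => tt n i < p -> tt n i < p - d).
- by move=> i d d' H d'0 d'd /H; lra.
- case: (ltP (tt n i) p) => ip; first by exists ((p - tt n i) / 2); lra.
  by exists 1.
exists eta => // u pu up; rewrite /qcov big_mkcond [X in _ - X]big_mkcond -sumrB.
rewrite [RHS]big_mkcond; apply: eq_bigr => i _.
case: (ltgtP (tt n i) p) => ip.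
- by case: (leP (tt n i) u) => ?; [rewrite subrr|have := He i ip; lra].
- by rewrite ifF ?subrr//; apply/negbTE; rewrite -ltNge; lra.
- by rewrite ifF ?subr0//; apply/negbTE; rewrite -ltNge; lra.
Qed.

Section Partition.
Variables (k : nat -> nat) (tt : nat -> nat -> R).
Hypothesis Hpart : fine_part k tt.

Lemma tt_ge0 n i : (i <= k n)%N -> 0 <= tt n i.
Proof. by case: Hpart => H0 Hi _ _ ik; rewrite -(H0 n); apply: (incr_upto_le (Hi n)). Qed.

Lemma qcov_jump x y n i : (i < k n)%N ->
  exists2 eta, 0 < eta & forall u, tt n i - eta <= u -> u < tt n i ->
  qcov k tt x y n (tt n i) - qcov k tt x y n u = incp tt x y n i.
Proof.
move=> ik; have [eta e0 He] := qcov_left k tt x y n (tt n i); exists eta => // u u1 u2.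
rewrite He// (big_pred1 (Ordinal ik))// => j /=.
case: Hpart => _ Hi _ _; apply/eqP/eqP => [E|->//]; apply/val_inj => /=.
have [ji|ij|//] := ltngtP j i.
- by have := incr_upto_lt (Hi n) ji (ltnW ik); rewrite E ltxx.
- by have := incr_upto_lt (Hi n) ij (ltnW (ltn_ord j)); rewrite E ltxx.
Qed.

Lemma qcov_nojump x y n p : (forall i, (i < k n)%N -> tt n i != p) ->
  exists2 eta, 0 < eta & forall u, p - eta <= u -> u < p ->
  qcov k tt x y n p = qcov k tt x y n u.
Proof.
move=> H; have [eta e0 He] := qcov_left k tt x y n p; exists eta => // u u1 u2.
by apply/eqP; rewrite -subr_eq0 He// big_pred0// => j; apply/negbTE/H.
Qed.

Lemma qcov_cadlag x y n : cadlagR (qcov k tt x y n).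
Proof.
apply: cadlag_from_llim => t t0.
- have [|i|eta e0 He] := @fin_small R 'I_(k n) (fun i d => t < tt n i -> t + d < tt n i).
  + by move=> i d d' H d'0 d'd /H; lra.
  + case: (ltP t (tt n i)) => ip; first by exists ((tt n i - t) / 2); lra.
    by exists 1.
  move=> e he; exists eta => // s ts st; suff -> : qcov k tt x y n s = qcov k tt x y n t.
    by rewrite subrr normr0.
  apply: eq_bigl => i; case: (leP (tt n i) t) => it; first by apply/idP; lra.
  by apply/negbTE; rewrite -ltNge; have := He i it; lra.
- have [eta e0 He] := qcov_left k tt x y n t.
  exists (qcov k tt x y n (t - eta)) => e he; exists eta => // s ts st.
  suff -> : qcov k tt x y n s = qcov k tt x y n (t - eta) by rewrite subrr normr0.
  have := He s (ltW ts) st; rewrite -(He (t - eta)) ?lexx//; last lra.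
  by move=> /addrI/oppr_inj.
Qed.

(** The increment from [tt n i] to [tt n i.+1] contains the jump at [s] exactly when
    [tt n i < s <= tt n i.+1]. This half-open convention defines the crossing interval
    throughout. *)
Lemma crossing_exists (s : R) : 0 < s -> exists N, forall n, (N <= n)%N ->
  exists2 i, (i < k n)%N & tt n i < s <= tt n i.+1.
Proof.
case: Hpart => H0 Hi Hinf _ s0; have [N HN] := Hinf s; exists N => n /HN sk.
by apply: incr_upto_locateL; rewrite ?H0// ltW.
Qed.

Lemma crossing_uniq n i j (s : R) : (i < k n)%N -> (j < k n)%N ->
  tt n i < s <= tt n i.+1 -> tt n j < s <= tt n j.+1 -> i = j.
Proof.
case: Hpart => _ Hi _ _ ik jk /andP[i1 i2] /andP[j1 j2].
have A := ltn_of_incr (Hi n) (ltnW ik) (lt_le_trans i1 j2).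
have B := ltn_of_incr (Hi n) (ltnW jk) (lt_le_trans j1 i2).
by lia.
Qed.

(** The right end tends to [s] from above, [s] included, and the left end from strictly below, so
    the increment tends to the value at [s] minus the left limit. *)
Lemma crossing_inc x s e : cadlagR x -> 0 < s -> 0 < e -> exists N, forall n, (N <= n)%N ->
  forall i, (i < k n)%N -> tt n i < s <= tt n i.+1 ->
  s - e < tt n i /\ `|x (tt n i.+1) - x (tt n i) - jumpR x s| < e.
Proof.
move=> /cadlagRP[xr xl] s0 e0; have e2 : 0 < e / 2 by lra.
have [d1 d10 H1] := xr s (ltW s0) _ e2; have [d2 d20 H2] := xl s s0 _ e2.
have m0 : 0 < Num.min e (Num.min d1 d2) by rewrite !lt_min e0 d10.
case: Hpart => _ _ _ Hm; have [N HN] := Hm s _ m0; exists N => n Nn i ik /andP[i1 i2].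
have := HN n Nn i ik (ltW i1); rewrite !lt_min => /and3P[me md1 md2].
split; first lra.
have := H1 (tt n i.+1) i2; have := H2 (tt n i); rewrite !ltr_norml.
have -> : tt n i.+1 < s + d1 by lra.
have -> : s - d2 < tt n i by lra.
rewrite i1 => /(_ isT isT)/andP[? ?] /(_ isT)/andP[? ?].
by apply/andP; split; lra.
Qed.

Lemma crossing_incp x y s e : cadlagR x -> cadlagR y -> 0 < s -> 0 < e ->
  exists N, forall n, (N <= n)%N ->
  forall i, (i < k n)%N -> tt n i < s <= tt n i.+1 ->
  s - e < tt n i /\ `|incp tt x y n i - jumpR x s * jumpR y s| <= e.
Proof.
move=> cx cy s0 e0; set a := jumpR x s; set b := jumpR y s.
have D0 : 0 < `|a| + `|b| + 1 by have := normr_ge0 a; have := normr_ge0 b; lra.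
(* With both increments within [e'] of [a] and [b], the expansion of [u * v - a * b] below is at
   most [e' * (e' + |a| + |b|)]; this explains the cap at 1 and the denominator. *)
pose e' := Num.min 1 (Num.min e (e / (`|a| + `|b| + 1))).
have e'0 : 0 < e' by rewrite !lt_min ltr01 e0 divr_gt0.
have [N1 H1] := crossing_inc cx s0 e'0; have [N2 H2] := crossing_inc cy s0 e'0.
exists (maxn N1 N2) => n; rewrite geq_max => /andP[n1 n2] i ik ci.
have [A1 A2] := H1 n n1 i ik ci; have [_ B2] := H2 n n2 i ik ci.
have e1 : e' <= 1 by rewrite ge_min lexx.
have e2 : e' <= e by rewrite !ge_min lexx orbT.
have e3 : e' * (`|a| + `|b| + 1) <= e.
  by rewrite -ler_pdivlMr// !ge_min lexx !orbT.
split; first lra.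
rewrite /incp; move: A2 B2; rewrite -/a -/b; clearbody e'.
set u := x _ - x _; set v := y _ - y _ => A2 B2.
have -> : u * v - a * b = (u - a) * (v - b) + (u - a) * b + a * (v - b) by ring.
apply: le_trans (ler_normD _ _) _; apply: le_trans (lerD (ler_normD _ _) (lexx _)) _.
rewrite !normrM; apply: le_trans e3.
have := normr_ge0 a; have := normr_ge0 b; have := normr_ge0 (u - a); have := normr_ge0 (v - b).
move: A2 B2; set p := `|u - a|; set q := `|v - b|; set a' := `|a|; set b' := `|b|.
by move=> *; nra.
Qed.

(** Both ends of the interval lie on the same side of [s], and a càdlàg path is nearly constant on
    each side close to [s]. At [s = 0] the left side is empty. *)
Lemma noncrossing_inc x s e : cadlagR x -> 0 <= s -> 0 < e ->
  exists2 d, 0 < d & exists N, forall n, (N <= n)%N ->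
  forall i, (i < k n)%N -> `|tt n i - s| < d -> ~ (tt n i < s <= tt n i.+1) ->
  `|x (tt n i.+1) - x (tt n i)| < e.
Proof.
move=> /cadlagRP[xr xl] s0 e0; have e2 : 0 < e / 2 by lra.
have [d1 d10 H1] := xr s s0 _ e2.
have [d2 d20 H2] : exists2 d, 0 < d & forall u v, s - d < u -> u < s -> 0 <= u ->
    s - d < v -> v < s -> `|x v - x u| < e.
  move: s0; rewrite le_eqVlt => /predU1P[<-|s0]; first by exists 1 => // u v; lra.
  have [d2 d20 H2] := xl s s0 _ e2; exists d2 => // u v u1 u2 _ v1 v2.
  have := H2 u u1 u2; have := H2 v v1 v2; rewrite !ltr_norml => /andP[? ?] /andP[? ?].
  by apply/andP; split; lra.
case: Hpart => _ Hi _ Hm; have d12 : 0 < d1 / 2 by lra.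
(* Left ends are kept within [d1 / 2] of [s] and the mesh below [d1 / 2], so right ends stay below
   [s + d1]. *)
have [N HN] := Hm (s + d1) _ d12.
have m1 : Num.min (d1 / 2) d2 <= d1 / 2 by rewrite ge_min lexx.
have m2 : Num.min (d1 / 2) d2 <= d2 by rewrite ge_min lexx orbT.
exists (Num.min (d1 / 2) d2); first by rewrite lt_min d20 d12.
exists N => n Nn i ik; rewrite ltr_norml => /andP[i1 i2] ni.
have := HN n Nn i ik; have -> : tt n i <= s + d1 by lra.
move=> /(_ isT) mi; have ii := Hi n i ik.
case: (leP s (tt n i)) => si.
  have := H1 (tt n i) si; have := H1 (tt n i.+1); rewrite !ltr_norml.
  have -> : s <= tt n i.+1 by lra.
  have -> : tt n i.+1 < s + d1 by lra.
  have -> : tt n i < s + d1 by lra.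
  by move=> /(_ isT isT)/andP[? ?] /(_ isT)/andP[? ?]; apply/andP; split; lra.
have si' : tt n i.+1 < s by rewrite ltNge; apply/negP => ?; apply: ni; rewrite si.
by apply: H2 => //; [lra|apply/tt_ge0/ltnW|lra].
Qed.

Lemma noncrossing_incp x y s e : cadlagR x -> cadlagR y -> 0 <= s -> 0 < e ->
  exists2 d, 0 < d & exists N, forall n, (N <= n)%N ->
  forall i, (i < k n)%N -> `|tt n i - s| < d -> ~ (tt n i < s <= tt n i.+1) ->
  `|incp tt x y n i| <= e.
Proof.
move=> cx cy s0 e0; have [d1 d10 [N1 H1]] := noncrossing_inc cx s0 e0.
have [d2 d20 [N2 H2]] := noncrossing_inc cy s0 ltr01.
exists (Num.min d1 d2); first by rewrite lt_min d10.
exists (maxn N1 N2) => n; rewrite geq_max => /andP[n1 n2] i ik.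
rewrite lt_min => /andP[id1 id2] ni.
have A := H1 n n1 i ik id1 ni; have B := H2 n n2 i ik id2 ni.
by rewrite normrM -[e]mulr1 ler_pM// ltW.
Qed.

(** Near [t] the values of [h] form two clusters, separated at [lm t]: a point [v] is [lm u] with
    [u < t] or [t <= u] according to its side of [lm t], and [h v] is then close to [Y u]. One [c]
    comes from [h], the other from the one-sided limit of [Y]. *)
Lemma time_change_clusters (h lm Y : R -> R) t d c J : 0 < d -> d <= t ->
  time_change lm -> (forall u, 0 <= u <= t + d -> `|lm u - u| <= d / 4 /\ `|h (lm u) - Y u| <= c) ->
  (forall u, t <= u -> u < t + d -> `|Y u - Y t| < c) ->
  (forall u, t - d < u -> u < t -> `|Y u - (Y t - J)| < c) ->
  [/\ t - d / 2 < lm t, lm t < t + d / 2,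
    forall v, t - d / 2 < v -> v < lm t -> `|h v - (Y t - J)| <= 2 * c &
    forall v, lm t <= v -> v < t + d / 2 -> `|h v - Y t| <= 2 * c].
Proof.
move=> d0 dt [_ _ lmono lsurj] H H1 H2.
have lml u : 0 <= u -> u <= t + d -> u - d / 4 <= lm u /\ lm u <= u + d / 4.
  by move=> u0 ud; have [] := H u; rewrite ?u0// ler_norml => /andP[A B] _; split; lra.
have [||ta1 ta2] := lml t; [lra|lra|].
have lt_of u u' : 0 <= u -> 0 <= u' -> lm u < lm u' -> u < u'.
  move=> u0 u'0 uu; rewrite ltNge; apply/negP; rewrite le_eqVlt => /predU1P[E|/(lmono _ _ u'0)].
    by move: uu; rewrite E ltxx.
  by move/(lt_trans uu); rewrite ltxx.
(* The bound on [lm] holds only up to [t + d], so preimages must first be confined. Any factor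
   strictly between 3/4 and 1 would do: the image of this point lies beyond [t + d / 2]. *)
have [||u91 u92] := lml (t + d * (9 / 10)); [lra|lra|].
split; [lra|lra| |].
- move=> v v1 v2; have [|u [u0 uv]] := lsurj v; first lra.
  have ut : u < t by apply: lt_of => //; [lra|rewrite uv].
  have [||w1 w2] := lml u; [lra|lra|].
  have [|_] := H u; first by apply/andP; split; lra.
  have := H2 u _ ut; rewrite uv => /(_ ltac:(lra)).
  rewrite ltr_norml !ler_norml => /andP[? ?] /andP[? ?].
  by apply/andP; split; lra.
- move=> v v1 v2; have [|u [u0 uv]] := lsurj v; first lra.
  have tu : t <= u.
    by rewrite leNgt; apply/negP => /(lmono _ _ u0); rewrite uv ltNge v1.
  have ut : u < t + d * (9 / 10) by apply: lt_of => //; lra.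
  have [|_] := H u; first by apply/andP; split; lra.
  have := H1 u tu; rewrite uv => /(_ ltac:(lra)).
  rewrite ltr_norml !ler_norml => /andP[? ?] /andP[? ?].
  by apply/andP; split; lra.
Qed.

Lemma jump_point_near (p w z : R) : 0 < w -> z < p -> exists u, [/\ p - w <= u, z < u & u < p].
Proof.
move=> w0 zp; exists (Num.max (p - w) ((p + z) / 2)).
rewrite le_max lexx lt_max gt_max; split=> //; first by apply/orP; right; lra.
by apply/andP; split; lra.
Qed.

(** Here [L] and [J] stand for the value and the jump of the limit at [t], [a] for the product of
    jumps, [sg] for the crossing point and [tau] for [lam t]. If [tau = sg], the same jump of [h] is
    close to both [J] and [a]. Otherwise the jump at [sg] stays inside one cluster, so [a] is small,
    while the jump at [tau] is small by assumption, so [J] is small. The factor 8 dominates all the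
    accumulated errors. *)
Lemma jump_match (h : R -> R) (t d c L J a inc sg tau : R) : 0 < c ->
  t - d < tau -> tau < t + d -> t - d < sg -> sg < t ->
  (forall v, t - d < v -> v < tau -> `|h v - (L - J)| <= 2 * c) ->
  (forall v, tau <= v -> v < t + d -> `|h v - L| <= 2 * c) ->
  (exists2 eta, 0 < eta & forall u, sg - eta <= u -> u < sg -> h sg - h u = inc) ->
  `|inc - a| <= c ->
  (tau != sg -> exists2 eta, 0 < eta & exists2 j, `|j| <= c &
      forall u, tau - eta <= u -> u < tau -> h tau - h u = j) ->
  ((tau < t /\ `|J - a| <= 8 * c) \/ (`|a| <= 8 * c /\ `|J| <= 8 * c)) /\ `|h t - L| <= 8 * c.
Proof.
move=> c0 ta1 ta2 is1 is2 L1 L2 [eta eta0 Heta] ia Hj.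
have [ts|ts] := eqVneq tau sg.
  subst tau; have [u [u1 u2 u3]] := jump_point_near eta0 is1.
  have A := Heta u u1 u3; have := L1 u u2 u3; have := L2 sg (lexx _) ta2.
  have td : t < t + d by lra.
  have := L2 t (ltW is2) td.
  move: ia; rewrite -A !ler_norml => /andP[? ?] /andP[? ?] /andP[? ?] /andP[? ?].
  split; last by apply/andP; split; lra.
  by left; split=> //; apply/andP; split; lra.
have ha : `|inc| <= 4 * c.
  have [st|st] := ltP sg tau.
    have [u [u1 u2 u3]] := jump_point_near eta0 is1.
    have := L1 u u2 (lt_trans u3 st); have := L1 sg is1 st; rewrite -(Heta u u1 u3).
    rewrite !ler_norml => /andP[? ?] /andP[? ?]; apply/andP; split; lra.
  have st' : tau < sg by rewrite lt_neqAle ts.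
  have [u [u1 u2 u3]] := jump_point_near eta0 st'.
  have sd : sg < t + d by lra.
  have := L2 u (ltW u2) (lt_trans u3 sd); have := L2 sg st sd; rewrite -(Heta u u1 u3).
  by rewrite !ler_norml => /andP[? ?] /andP[? ?]; apply/andP; split; lra.
have [eta' eta'0 [j jc {}Hj]] := Hj ts.
have hJ : `|J| <= 5 * c.
  have [u [u1 u2 u3]] := jump_point_near eta'0 ta1.
  have := L1 u u2 u3; have := L2 tau (lexx _) ta2; move: jc; rewrite -(Hj u u1 u3).
  rewrite !ler_norml => /andP[? ?] /andP[? ?] /andP[? ?]; apply/andP; split; lra.
clear Hj Heta; split.
  right; split; last lra.
  by move: ha ia; rewrite !ler_norml => /andP[? ?] /andP[? ?]; apply/andP; split; lra.
have td : t < t + d by lra.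
have td' : t - d < t by lra.
have [tt1|tt1] := leP tau t; first by have := L2 t tt1 td; lra.
have := L1 t td' tt1; move: hJ; rewrite !ler_norml => /andP[? ?] /andP[? ?].
by apply/andP; split; lra.
Qed.

(* A jump of the limit at [t] must be matched, through the time change, by a jump of
   [qcov] at a nearby partition point; only the point [tt n i < t <= tt n i.+1] carries an
   increment that does not vanish, and its increment is close to the jump product. *)
Lemma J1_qcov_dichotomy x y Y (lam : nat -> R -> R) t e :
  cadlagR x -> cadlagR y -> cadlagR Y -> (forall n, time_change (lam n)) ->
  (forall T eps, 0 < eps -> exists N, forall n, (N <= n)%N -> forall t, 0 <= t <= T ->
     `|lam n t - t| <= eps /\ distR (qcov k tt x y n (lam n t)) (Y t) <= eps) ->
  0 < t -> 0 < e -> exists N, forall n, (N <= n)%N ->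
    ((lam n t < t /\ `|jumpR Y t - jumpR x t * jumpR y t| <= e) \/
     (`|jumpR x t * jumpR y t| <= e /\ `|jumpR Y t| <= e)) /\
    `|qcov k tt x y n t - Y t| <= e.
Proof.
move=> cx cy /cadlagRP[Yr Yl] lamT HJ t0 e0.
have [c c0 ->] : exists2 c, 0 < c & e = 8 * c by exists (e / 8); lra.
have [d1 d10 H1] := Yr t (ltW t0) _ c0; have [d2 d20 H2] := Yl t t0 _ c0.
have [d3 d30 [N3 H3]] := noncrossing_incp cx cy (ltW t0) c0.
pose d := Num.min t (Num.min d1 (Num.min d2 d3)).
have d0 : 0 < d by rewrite !lt_min t0 d10 d20.
have dt : d <= t by rewrite ge_min lexx.
have dd1 : d <= d1 by rewrite !ge_min lexx orbT.
have dd2 : d <= d2 by rewrite !ge_min lexx !orbT.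
have dd3 : d <= d3 by rewrite !ge_min lexx !orbT.
clearbody d.
have m0 : 0 < Num.min c (d / 4) by rewrite lt_min c0; lra.
have [N4 H4] := HJ (t + d) _ m0.
have [N5 H5] := crossing_exists t0; have [N6 H6] := crossing_incp cx cy t0 m0.
have m1 : Num.min c (d / 4) <= c by rewrite ge_min lexx.
have m2 : Num.min c (d / 4) <= d / 4 by rewrite ge_min lexx orbT.
exists (maxn (maxn N3 N4) (maxn N5 N6)) => n.
rewrite !geq_max => /andP[/andP[n3 n4] /andP[n5 n6]].
have [i ik ci] := H5 n n5; have [is1 is2] := H6 n n6 i ik ci.
have [ci1 _] := andP ci.
have [||||ta1 ta2 L1 L2] := @time_change_clusters (qcov k tt x y n) (lam n) Y t d c (jumpR Y t) d0 dt.
- exact: lamT.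
- by move=> u /(H4 n n4)[A B]; split; [apply: le_trans A m2|apply: le_trans B m1].
- by move=> u tu ud; apply: H1 => //; apply: lt_le_trans ud _; rewrite lerD2l.
- by move=> u ud; apply: H2; apply: le_lt_trans ud; rewrite lerD2l lerN2.
apply: (jump_match c0 ta1 ta2 _ ci1 L1 L2 (qcov_jump x y ik) (le_trans is2 m1)).
  by apply: le_lt_trans is1; rewrite lerD2l lerN2; apply: le_trans m2 _; lra.
move=> ts.
(* Away from the crossing point, [lam n t] is either another partition point, whose increment is
   small, or no partition point, where [qcov] does not jump. *)
have [[j [jk jE]]|nj] := pselect (exists j, (j < k n)%N /\ tt n j = lam n t).
  have [eta eta0 He] := qcov_jump x y jk; rewrite jE in He.
  exists eta => //; exists (incp tt x y n j); last exact: He.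
  apply: H3 => //; first by rewrite jE ltr_norml; apply/andP; split; lra.
  by move=> cj; move: ts; rewrite -jE -(crossing_uniq ik jk ci cj) eqxx.
have [|eta eta0 He] := @qcov_nojump x y n (lam n t).
  by move=> j jk; apply/eqP => jE; apply: nj; exists j.
exists eta => //; exists 0; first by rewrite normr0 ltW.
by move=> u u1 u2; rewrite (He u)// subrr.
Qed.

(** What survives of J1 convergence once the time changes are forgotten; it suffices to recover that
    convergence. *)
Definition qcov_limit x y Y := (forall t, 0 < t -> jumpR Y t = jumpR x t * jumpR y t) /\
  (forall t, 0 <= t -> forall e, 0 < e -> exists N, forall n, (N <= n)%N ->
     `|qcov k tt x y n t - Y t| <= e).

Lemma J1_qcov_limit x y Y : cadlagR x -> cadlagR y -> cadlagR Y ->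
  J1conv (@distR R) (qcov k tt x y) Y -> qcov_limit x y Y.
Proof.
move=> cx cy cY [lam [lamT HJ]]; split=> t t0; last first.
  move: t0; rewrite le_eqVlt => /predU1P[<-|t0] e e0; last first.
    have [N HN] := J1_qcov_dichotomy cx cy cY lamT HJ t0 e0.
    by exists N => n /HN[].
  have [N HN] := HJ 0 e e0; exists N => n /HN/(_ 0); rewrite lexx => /(_ isT)[_].
  by have [-> _ _ _] := lamT n.
apply/eqP; apply: contrapT => /negP; rewrite -subr_eq0 -normr_gt0 => D0.
(* With a third of the distance [D] between the two sides, the first alternative gives [D <= D / 3]
   and the second [D <= 2 * D / 3]; both are absurd. *)
have [|N HN] := J1_qcov_dichotomy cx cy cY lamT HJ t0 (e := `|jumpR Y t - jumpR x t * jumpR y t| / 3).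
  lra.
have [[[_ H]|[H1 H2]] _] := HN N (leqnn _); first lra.
have := ler_normB (jumpR Y t) (jumpR x t * jumpR y t); lra.
Qed.

(* With the identity time change the first alternative of the dichotomy is void. *)
Lemma unif_qcov_nojump x y Y : cadlagR x -> cadlagR y -> cadlagR Y ->
  (forall T eps, 0 < eps -> exists N, forall n, (N <= n)%N -> forall t, 0 <= t <= T ->
     `|qcov k tt x y n t - Y t| <= eps) ->
  forall t, 0 < t -> jumpR x t * jumpR y t = 0.
Proof.
move=> cx cy cY HU t t0; apply/eqP; apply: contrapT => /negP; rewrite -normr_gt0 => D0.
have D2 : 0 < `|jumpR x t * jumpR y t| / 2 by lra.
have [|T eps e0|N HN] := @J1_qcov_dichotomy x y Y (fun=> id) t _ cx cy cY _ _ t0 D2.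
- by move=> _; apply: time_change_id.
- have [N HN] := HU T eps e0; exists N => n /HN H s /H Hs; split=> //.
  by rewrite subrr normr0 ltW.
have [[[]|[]]] := HN N (leqnn _); first by rewrite ltxx.
by lra.
Qed.

End Partition.
End QuadraticCovariation.

(** * Pointwise convergence implies J1 convergence *)

Section MonotoneApproximation.
Variables (R : realType) (k : nat -> nat) (tt : nat -> nat -> R).
Hypothesis Hpart : fine_part k tt.

Local Notation sq x := (qcov k tt x x).

Lemma qcov_le (x : R -> R) n u v : u <= v -> sq x n u <= sq x n v.
Proof.
move=> uv; rewrite /qcov big_mkcond [leRHS]big_mkcond; apply: ler_sum => i _.
case: (leP (tt n i) u) => iu; first by rewrite (le_trans iu uv).
by case: ifP => // _; rewrite /incp -expr2 sqr_ge0.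
Qed.

Lemma qcov_below (x : R -> R) n i u : (i < k n)%N -> u < tt n i ->
  sq x n u <= sq x n (tt n i) - incp tt x x n i.
Proof.
move=> ik ui; have [eta e0 He] := qcov_jump Hpart x x ik.
have m1 : u <= Num.max u (tt n i - eta) by rewrite le_max lexx.
have m2 : tt n i - eta <= Num.max u (tt n i - eta) by rewrite le_max lexx orbT.
have m3 : Num.max u (tt n i - eta) < tt n i by rewrite gt_max ui; lra.
have := He _ m2 m3; have := qcov_le x n m1; lra.
Qed.

Lemma rat_between (a b : R) : a < b -> exists r : rat, a < ratr r < b.
Proof.
by move=> ab; have [r] := rat_in_itvoo ab; rewrite in_itv/= => H; exists r.
Qed.

(** Only countably many times are used, so that one subsequence can provide almost sure convergence
    at all of them. *)
Definition rat_limit (h : nat -> R -> R) (Y : R -> R) := forall r : rat, 0 <= r ->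
  forall e, 0 < e -> exists N, forall n, (N <= n)%N -> `|h n (ratr r) - Y (ratr r)| <= e.

(** Squeeze with rationals [r1 < tt n i < s < r2]. From above, [sq x n r2] is close to [G s]. From
    below, [sq x n r1] plus the crossing increment is close to the left limit of [G] plus its jump,
    which is again [G s]. *)
Lemma crossing_value (x G : R -> R) s e : cadlagR x -> cadlagR G ->
  jumpR G s = jumpR x s * jumpR x s -> rat_limit (sq x) G -> 0 < s -> 0 < e ->
  exists N, forall n, (N <= n)%N -> forall i, (i < k n)%N -> tt n i < s <= tt n i.+1 ->
    `|sq x n (tt n i) - G s| <= e.
Proof.
move=> cx /cadlagRP[Gr Gl] J H s0 e0.
have c0 : 0 < e / 4 by lra.
have [d1 d10 H1] := Gr s (ltW s0) _ c0; have [d2 d20 H2] := Gl s s0 _ c0.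
have [|r1 /andP[]] := @rat_between (Num.max 0 (s - d2)) s; first by rewrite gt_max s0; lra.
rewrite gt_max => /andP[r10 r1d] r1s.
have [|r2 /andP[r2s r2d]] := @rat_between s (s + d1); first lra.
have r20 : 0 < r2 by rewrite -(ltr0q R); lra.
have r10' : 0 < r1 by rewrite -(ltr0q R).
have [N1 K1] := H r1 (ltW r10') _ c0; have [N2 K2] := H r2 (ltW r20) _ c0.
(* The second term forces the crossing point to lie above [r1]. *)
have m0 : 0 < Num.min (e / 4) (s - ratr r1) by rewrite lt_min c0; lra.
have [N3 K3] := crossing_incp Hpart cx cx s0 m0.
exists (maxn N1 (maxn N2 N3)) => n; rewrite !geq_max => /and3P[n1 n2 n3] i ik ci.
have [ci1 _] := andP ci; have [A B] := K3 n n3 i ik ci.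
have m1 : Num.min (e / 4) (s - ratr r1) <= e / 4 by rewrite ge_min lexx.
have m2 : Num.min (e / 4) (s - ratr r1) <= s - ratr r1 by rewrite ge_min lexx orbT.
have {}B := le_trans B m1.
have ri : ratr r1 < tt n i by lra.
have D := qcov_below x ik ri; have E := qcov_le x n (ltW (lt_trans ci1 r2s)).
have := K1 n n1; have := K2 n n2; have := H1 _ (ltW r2s) r2d; have := H2 _ r1d r1s.
move: B; rewrite -J !ler_norml !ltr_norml => /andP[? ?] /andP[? ?] /andP[? ?] /andP[? ?] /andP[? ?].
by apply/andP; split; lra.
Qed.

(* On [s_l, s_(l+1)[ the limits [G a] oscillate little; the time change sends each [s_l] to the
   partition point whose increment straddles it, so that monotonicity traps [sq (x a)]. *)
Lemma squares_J1 (A : finType) (x G : A -> R -> R) :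
  (forall a, cadlagR (x a)) -> (forall a, cadlagR (G a)) ->
  (forall a t, 0 < t -> jumpR (G a) t = jumpR (x a) t * jumpR (x a) t) ->
  (forall a, rat_limit (sq (x a)) (G a)) ->
  forall T eps : R, 0 < eps -> exists N, forall n, (N <= n)%N ->
  exists2 lam, time_change lam & forall t, 0 <= t <= T ->
    `|lam t - t| <= eps /\ forall a, `|sq (x a) n (lam t) - G a t| <= eps.
Proof.
move=> cx cG J H T eps e0; have c0 : 0 < eps / 4 by lra.
have [r [s [s0 si Ts so]]] := cadlag_partition T cG c0.
have spos l : (l < r)%N -> 0 < s l.+1.
  by move=> lr; rewrite -s0; apply: (incr_upto_lt si).
have [N0 K0] : exists N, forall n, (N <= n)%N -> forall a, `|sq (x a) n 0 - G a 0| <= eps / 4.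
  apply: fin_eventually => a; have [N HN] := H a 0 (lexx _) _ c0.
  by exists N => n /HN; rewrite rmorph0.
have [N1 K1] : exists N, forall n, (N <= n)%N -> forall l : 'I_r,
    exists2 i, (i < k n)%N & [/\ tt n i < s l.+1, s l < tt n i, `|tt n i - s l.+1| <= eps &
      forall a, `|sq (x a) n (tt n i) - G a (s l.+1)| <= eps / 4 /\
       `|incp tt (x a) (x a) n i - jumpR (G a) (s l.+1)| <= eps / 4].
  apply: fin_eventually => l; have sl := spos l (ltn_ord l).
  have [N1 H1] := crossing_exists Hpart sl.
  have m0 : 0 < Num.min eps (s l.+1 - s l) by rewrite lt_min e0 subr_gt0; apply: si.
  (* Applied to the zero path, this only locates the crossing point: within [eps] of [s l.+1], and
     above [s l] so that the images of the nodes stay increasing. *)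
  have [N2 H2] := crossing_inc Hpart (cadlag_cst 0) sl m0.
  have [N3 H3] : exists N, forall n, (N <= n)%N -> forall a, forall i, (i < k n)%N ->
      tt n i < s l.+1 <= tt n i.+1 -> `|sq (x a) n (tt n i) - G a (s l.+1)| <= eps / 4.
    by apply: fin_eventually => a; apply: crossing_value => //; apply: J.
  have [N4 H4] : exists N, forall n, (N <= n)%N -> forall a, forall i, (i < k n)%N ->
      tt n i < s l.+1 <= tt n i.+1 ->
      `|incp tt (x a) (x a) n i - jumpR (G a) (s l.+1)| <= eps / 4.
    apply: fin_eventually => a; have [N HN] := crossing_incp Hpart (cx a) (cx a) sl c0.
    by exists N => n /HN{}HN i ik ci; rewrite J//; have [] := HN i ik ci.
  exists (maxn (maxn N1 N2) (maxn N3 N4)) => n.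
  rewrite !geq_max => /andP[/andP[n1 n2] /andP[n3 n4]].
  have [i ik ci] := H1 n n1; exists i => //; have [A1 _] := H2 n n2 i ik ci.
  have [ci1 ci2] := andP ci.
  have m1 : Num.min eps (s l.+1 - s l) <= eps by rewrite ge_min lexx.
  have m2 : Num.min eps (s l.+1 - s l) <= s l.+1 - s l by rewrite ge_min lexx orbT.
  split=> //; [lra| |].
  - by rewrite ltr0_norm; lra.
  - by move=> a; split; [apply: H3|apply: H4].
exists (maxn N0 N1) => n; rewrite geq_max => /andP[n0 n1].
have {}K0 := K0 n n0; have {K1 n1} /choice[f Hf] l : exists i, (l < r)%N -> (i < k n)%N /\
    [/\ tt n i < s l.+1, s l < tt n i, `|tt n i - s l.+1| <= eps &
      forall a, `|sq (x a) n (tt n i) - G a (s l.+1)| <= eps / 4 /\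
       `|incp tt (x a) (x a) n i - jumpR (G a) (s l.+1)| <= eps / 4].
  case: (ltnP l r) => lr; last by exists 0%N.
  by have [i ik Hi] := K1 n n1 (Ordinal lr); exists i.
pose sg l := if l is l'.+1 then tt n (f l') else 0.
have sgs l : (l <= r)%N -> sg l <= s l.
  by case: l => [|l] lr; [rewrite /= s0|have [_ []] := Hf l lr => /ltW].
have sgi : incr_upto r sg.
  by move=> l lr; have [_ [_ B _ _]] := Hf l lr; apply: le_lt_trans B; apply/sgs/ltnW.
have sgd l : (l <= r)%N -> `|sg l - s l| <= eps.
  by case: l => [|l] lr; [rewrite /= s0 subrr normr0 ltW|have [_ []] := Hf l lr].
have [lam [lamT lamE lamd]] := time_change_interp s0 erefl si sgi sgd.
exists lam => // t /andP[t0 tT]; split=> [|a]; first exact: lamd.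
have [||l lr /andP[t1 t2]] := @incr_upto_locate _ r s t; [by rewrite s0|lra|].
have [_ _ lmono _] := lamT.
have L1 : sg l <= lam t.
  rewrite -(lamE l (ltnW lr)); move: t1; rewrite le_eqVlt => /predU1P[->//|].
  by move=> /lmono/ltW; apply; rewrite -s0; apply: (incr_upto_le si) => //; apply: ltnW.
have L2 : lam t < sg l.+1 by rewrite -(lamE l.+1 lr); apply: lmono.
have [fk [_ _ _ /(_ a)[F1 F2]]] := Hf l lr.
(* Upper half of the trap: before the next node's image, the sum is at most its value there minus
   the crossing increment, which is close to the left limit of [G a] at [s l.+1]. *)
have U := qcov_below (x a) fk L2.
have lo : sq (x a) n (sg l) >= G a (s l) - eps / 4.
  case: (l) lr => [|l'] lr /=.
    by have := K0 a; rewrite s0 ler_norml => /andP[? ?]; lra.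
  have [_ [_ _ _ /(_ a)[]]] := Hf l' (ltnW lr).
  by rewrite ler_norml => /andP[? ?] _; lra.
have lo' := qcov_le (x a) n L1.
have O1 : `|G a t - G a (s l)| <= eps / 4.
  by apply: (so l lr); rewrite ?t1 ?lexx ?t2 /= ?si.
have /cadlagRP[_ /(_ _ (spos l lr) _ c0)[d d0 Hd]] := cG a.
(* The point [t'] lies in the same piece as [t] and close to its right end, so it links [G a t] to
   the left limit at [s l.+1]. *)
have ex : exists2 t', s l <= t' < s l.+1 & s l.+1 - d < t'.
  exists (Num.max t (s l.+1 - d / 2)).
    rewrite gt_max le_max t1 t2 /=; lra.
  by rewrite lt_max; apply/orP; right; lra.
have [t' t'1 t'2] := ex; have O2 : `|G a t' - G a t| <= eps / 4.
  by apply: (so l lr); rewrite ?t1 ?t2.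
have := Hd t' t'2; have -> : t' < s l.+1 by case/andP: t'1.
move=> /(_ isT) O3; move: F1 F2 O1 O2 O3; rewrite !ler_norml ltr_norml.
move=> /andP[? ?] /andP[? ?] /andP[? ?] /andP[? ?] /andP[? ?].
by apply/andP; split; lra.
Qed.

Lemma qcovDD (x y : R -> R) n t :
  qcov k tt (fun u => x u + y u) (fun u => x u + y u) n t =
  sq x n t + sq y n t + 2 * qcov k tt x y n t.
Proof.
rewrite /qcov mulr_sumr -!big_split; apply: eq_bigr => i _.
by rewrite /incp /=; ring.
Qed.

(** The pairs [(i, j)] index the paths [x i + x j], all controlled by one time change. The pair
    [(i, i)] gives the path [2 * x i], hence the diagonal entries, and polarization gives the
    others. *)
Lemma qcov_mx_J1 (d : nat) (x : 'I_d -> R -> R) (q : nat -> R -> 'M[R]_d) (Y : R -> 'M[R]_d) :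
  (forall n t i j, q n t i j = qcov k tt (x i) (x j) n t) ->
  (forall i, cadlagR (x i)) -> cadlag_mx Y ->
  (forall i j t, 0 < t -> jumpR (fun u => Y u i j) t = jumpR (x i) t * jumpR (x j) t) ->
  (forall i j, rat_limit (qcov k tt (x i) (x j)) (fun u => Y u i j)) ->
  J1conv (@dist_mx R d d) q Y.
Proof.
move=> qE cx cY J H; apply: J1convI => T eps e0.
pose X (a : 'I_d * 'I_d) u := x a.1 u + x a.2 u.
pose G (a : 'I_d * 'I_d) u := Y u a.1 a.1 + Y u a.2 a.2 + 2 * Y u a.1 a.2.
have cYZ i j : cadlagR (fun u => 2 * Y u i j) by apply: (cadlagZ 2 (cY i j)).
have cYD i j : cadlagR (fun u => Y u i i + Y u j j) by apply: cadlagD.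
(* [dist_mx] sums [d * d] entries; the successor covers [d = 0]. *)
have e0' : 0 < eps / (d * d).+1%:R by rewrite divr_gt0.
have [|a|a t t0|a r r0 e he|N HN] := @squares_J1 _ X G _ _ _ _ T _ e0'.
- by move=> a; apply: cadlagD.
- exact: cadlagD.
- rewrite (jumpD t0 (cYD _ _) (cYZ _ _)) (jumpD t0 (cY _ _) (cY _ _)) (jumpZ _ t0 (cY _ _)).
  by rewrite !J// (jumpD t0 (cx _) (cx _)); ring.
- have h4 : 0 < e / 4 by lra.
  have [N1 H1] := H a.1 a.1 r r0 _ h4; have [N2 H2] := H a.2 a.2 r r0 _ h4.
  have [N3 H3] := H a.1 a.2 r r0 _ h4.
  exists (maxn N1 (maxn N2 N3)) => n; rewrite !geq_max => /and3P[/H1 + /H2 + /H3].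
  rewrite /X /G qcovDD !ler_norml => /andP[? ?] /andP[? ?] /andP[? ?].
  by apply/andP; split; lra.
exists N => n /HN[lam lamT Hl]; exists lam => // t /Hl[A B]; split.
  apply: le_trans A _; rewrite ler_pdivrMr// ler_peMr ?ler1n ?(ltW e0)//.
apply: (@le_trans _ _ (\sum_(i < d) \sum_(j < d) (eps / (d * d).+1%:R))); last first.
  rewrite !sumr_const card_ord -mulrnA -[leLHS]mulr_natr -mulrA ler_piMr ?(ltW e0)//.
  by rewrite mulrC ler_pdivrMr// mul1r ler_nat.
apply: ler_sum => i _; apply: ler_sum => j _; rewrite qE.
have := B (i, j); have := B (i, i); have := B (j, j); rewrite /X /G !qcovDD /=.
move: (eps / (d * d).+1%:R) => e1.
rewrite !ler_norml => /andP[? ?] /andP[? ?] /andP[? ?].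
by apply/andP; split; lra.
Qed.
End MonotoneApproximation.

(** * Unconditional sums of jumps *)

Section Sums.
Variable R : realType.
Implicit Types (a F : R -> R) (A : set R).

Lemma sum_uniq_extend a (l l0 : seq R) : uniq l -> uniq l0 -> {subset l0 <= l} ->
  \sum_(s <- l) a s = \sum_(s <- l0) a s + \sum_(s <- [seq r <- l | r \notin l0]) a s.
Proof.
move=> ul ul0 sub; rewrite -big_cat; apply: perm_big; apply: uniq_perm => //.
- rewrite cat_uniq ul0 filter_uniq// andbT/=; apply/hasPn => r.
  by rewrite mem_filter => /andP[].
- move=> r; rewrite mem_cat mem_filter.
  by case: (boolP (r \in l0)) => //= /sub.
Qed.

Lemma has_sumD f g A u v : has_sum f A u -> has_sum g A v ->
  has_sum (fun s => f s + g s) A (u + v : R).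
Proof.
move=> Hf Hg e e0; have e2 : 0 < e / 2 by lra.
have [l1 [s1 H1]] := Hf _ e2; have [l2 [s2 H2]] := Hg _ e2.
exists (l1 ++ l2); split=> [s|l ul sl sub].
  by rewrite mem_cat => /orP[/s1|/s2].
have S1 s : s \in l1 -> s \in l by move=> h; apply: sub; rewrite mem_cat h.
have S2 s : s \in l2 -> s \in l by move=> h; apply: sub; rewrite mem_cat h orbT.
have := H1 l ul sl S1; have := H2 l ul sl S2.
rewrite big_split/= !ltr_norml => /andP[? ?] /andP[? ?].
by apply/andP; split; lra.
Qed.

Lemma has_sumZ c f A u : has_sum f A u -> has_sum (fun s => c * f s) A (c * u : R).
Proof.
move=> Hf e e0; have D0 : 0 < `|c| + 1 by have := normr_ge0 c; lra.
have [l0 [s0 H0]] := Hf _ (divr_gt0 e0 D0); exists l0; split=> // l ul sl sub.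
rewrite -mulr_sumr -mulrBr normrM.
have := H0 l ul sl sub; rewrite ltr_pdivlMr// mulrDr mulr1 mulrC.
by have := normr_ge0 (\sum_(s <- l) f s - u); lra.
Qed.

Lemma has_sum_ext f g A u : (forall s, A s -> f s = g s) -> has_sum f A u -> has_sum g A (u : R).
Proof.
move=> fg Hf e e0; have [l0 [s0 H0]] := Hf _ e0; exists l0; split=> // l ul sl sub.
by rewrite -(eq_big_seq _ (fun s h => fg s (sl s h))); apply: H0.
Qed.

Lemma has_sum_bounded a A (B : R) : (forall s, A s -> 0 <= a s) ->
  (forall l : seq R, uniq l -> (forall s, s \in l -> A s) -> \sum_(s <- l) a s <= B) ->
  exists v, has_sum a A v.
Proof.
move=> a0 HB.
pose E : set R := [set v | exists l : seq R, [/\ uniq l, forall s, s \in l -> A s & v = \sum_(s <- l) a s]].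
have hs : has_sup E.
  split; first by exists 0, [::]; rewrite big_nil.
  by exists B => v [l [ul sl ->]]; apply: HB.
exists (sup E) => e e0; have [v [l0 [ul0 sl0 ->]] Hv] := sup_adherent e0 hs.
exists l0; split=> // l ul sl sub.
have H1 : \sum_(s <- l) a s <= sup E by apply: ub_le_sup; [case: hs|exists l].
have H2 : 0 <= \sum_(s <- [seq r <- l | r \notin l0]) a s.
  rewrite big_seq; apply: sumr_ge0 => s; rewrite mem_filter => /andP[_ h].
  exact/a0/sl.
have := sum_uniq_extend a ul ul0 sub.
by rewrite ltr_norml => ?; apply/andP; split; lra.
Qed.

(** A single finite set [l0] of exceptional points serves all [s <= t <= T]; this uniformity is what
    controls [F] near a given time. *)
Lemma has_sum_increment a F (T e : R) : (forall t, 0 <= t -> has_sum a `]0, t] (F t)) ->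
  0 <= T -> 0 < e -> exists l0 : seq R, forall (s t : R) (l' : seq R),
    0 <= s -> s <= t -> t <= T -> uniq l' -> (forall r, r \in l' -> s < r <= t) ->
    (forall r, r \in l0 -> s < r <= t -> r \in l') ->
    `|F t - F s - \sum_(r <- l') a r| <= e.
Proof.
move=> HF T0 e0; have c0 : 0 < e / 4 by lra.
have [l0 [sl0 H0]] := HF T T0 _ c0; exists l0 => s t l' s0 st tT ul' sl' cl'.
have [ls [sls Hs]] := HF s s0 _ c0; have [lt [slt Ht]] := HF t (le_trans s0 st) _ c0.
have in1 r u : (`]0, u]%classic r : Prop) <-> 0 < r <= u by rewrite /= in_itv.
(* [Ls] approximates [F s], and [Ls] together with [l'] and [K] approximates [F t], so the error is
   the sum over [K]. Since [K] avoids [l0], this sum is the difference of two sums over sets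
   containing [l0], [W] with and without [K], and both are close to [F T]. *)
pose Ls := undup (ls ++ [seq r <- lt | r <= s]).
pose K := [seq r <- undup lt | (s < r <= t) && (r \notin l')].
have Kst r : r \in K -> s < r <= t by rewrite mem_filter => /andP[/andP[]].
have Ls_in r : r \in Ls -> 0 < r <= s.
  rewrite mem_undup mem_cat => /orP[/sls/in1//|]; rewrite mem_filter => /andP[rs /slt/in1].
  by rewrite rs => /andP[->].
have uK : uniq K by rewrite filter_uniq// undup_uniq.
have ulK : uniq (l' ++ K).
  rewrite cat_uniq ul' uK andbT/=; apply/hasPn => r.
  by rewrite mem_filter => /andP[/andP[]].
have lK_in r : r \in l' ++ K -> s < r <= t by rewrite mem_cat => /orP[/sl'|/Kst].
have A1 : `|\sum_(r <- Ls) a r - F s| < e / 4.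
  apply: Hs; [exact: undup_uniq|by move=> r /Ls_in ?; apply/in1|].
  by move=> r rl; rewrite mem_undup mem_cat rl.
have A2 : `|\sum_(r <- Ls ++ (l' ++ K)) a r - F t| < e / 4.
  apply: Ht.
  - rewrite cat_uniq undup_uniq ulK andbT/=; apply/hasPn => r /lK_in/andP[sr _].
    by apply/negP => /Ls_in/andP[_]; rewrite leNgt sr.
  - move=> r; rewrite mem_cat => /orP[/Ls_in/andP[r0 rs]|/lK_in/andP[sr rt]]; apply/in1.
      by rewrite r0 (le_trans rs).
    by rewrite rt (le_lt_trans s0).
  - move=> r rlt; rewrite mem_cat; case: (leP r s) => rs.
      by rewrite mem_undup mem_cat mem_filter rs rlt orbT.
    rewrite mem_cat mem_filter mem_undup rlt rs andbT /=.
    have /in1/andP[_ ->] := slt r rlt; rewrite /=.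
    by case: (r \in l'); rewrite ?orbT.
pose W := undup (l0 ++ l').
have W_in r : r \in W -> 0 < r <= T.
  rewrite mem_undup mem_cat => /orP[/sl0/in1//|/sl'/andP[sr rt]].
  by rewrite (le_trans rt tT) (le_lt_trans s0 sr).
have A3 : `|\sum_(r <- W) a r - F T| < e / 4.
  apply: H0; [exact: undup_uniq|by move=> r /W_in ?; apply/in1|].
  by move=> r rl; rewrite mem_undup mem_cat rl.
have A4 : `|\sum_(r <- W ++ K) a r - F T| < e / 4.
  apply: H0.
  - rewrite cat_uniq undup_uniq uK andbT/=; apply/hasPn => r rK.
    rewrite mem_undup mem_cat; have := rK; rewrite mem_filter => /andP[/andP[H nl'] _].
    by rewrite (negbTE nl') orbF; apply: contra nl' => /cl'; apply.
  - move=> r; rewrite mem_cat => /orP[/W_in H|/Kst/andP[sr rt]]; apply/in1 => //.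
    by rewrite (le_trans rt tT) (le_lt_trans s0 sr).
  - by move=> r rl; rewrite mem_cat mem_undup mem_cat rl.
move: A1 A2 A3 A4; rewrite !big_cat /= !ltr_norml.
move=> /andP[? ?] /andP[? ?] /andP[? ?] /andP[? ?].
by rewrite ler_norml; apply/andP; split; lra.
Qed.

Lemma seq_gap (l : seq R) t : exists2 d, 0 < d &
  forall r, r \in l -> (t < r -> t + d <= r) /\ (r < t -> r <= t - d).
Proof.
elim: l => [|r l [d d0 Hd]]; first by exists 1.
case: (eqVneq r t) => [->|rt].
  by exists d => // u; rewrite inE => /predU1P[->|/Hd//]; rewrite ltxx.
have m0 : 0 < Num.min d `|r - t| by rewrite lt_min d0 normr_gt0 subr_eq0.
have m1 : Num.min d `|r - t| <= d by rewrite ge_min lexx.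
have m2 : Num.min d `|r - t| <= `|r - t| by rewrite ge_min lexx orbT.
exists (Num.min d `|r - t|) => // u; rewrite inE => /predU1P[->|/Hd[A B]].
  by split=> h; move: m2; [rewrite gtr0_norm|rewrite ltr0_norm]; lra.
by split=> [/A|/B]; lra.
Qed.

(** Close to [t], the finite exceptional set contains no point other than possibly [t]. Increments
    ending at [t] are thus close to [a t], and increments starting at [t] close to 0. *)
Lemma has_sum_cadlag a F : (forall t, 0 <= t -> has_sum a `]0, t] (F t)) ->
  cadlagR F /\ forall t, 0 < t -> jumpR F t = a t.
Proof.
move=> HF.
have L t : 0 < t -> llim F t (F t - a t).
  move=> t0 e e0; have e2 : 0 < e / 2 by lra.
  have [l0 H0] := has_sum_increment HF (ltW t0) e2.
  have [d d0 Hd] := seq_gap l0 t; exists (Num.min d t); first by rewrite lt_min d0.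
  have m1 : Num.min d t <= d by rewrite ge_min lexx.
  have m2 : Num.min d t <= t by rewrite ge_min lexx orbT.
  move=> s s1 s2; have s0 : 0 <= s by lra.
  have := H0 s t [:: t] s0 (ltW s2) (lexx _) isT; rewrite big_seq1.
  have C1 r : r \in [:: t] -> s < r <= t by rewrite inE => /eqP ->; rewrite s2 lexx.
  have C2 r : r \in l0 -> s < r <= t -> r \in [:: t].
    move=> rl /andP[sr]; rewrite inE le_eqVlt => /orP[//|rt].
    by have [_ /(_ rt)] := Hd r rl; lra.
  move=> /(_ C1 C2); rewrite ler_norml ltr_norml => /andP[? ?].
  by apply/andP; split; lra.
split; last by move=> t /L/llim_jump ->; ring.
apply: cadlag_from_llim => t t0; last by exists (F t - a t); apply: L.
move=> e e0; have e2 : 0 < e / 2 by lra.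
have [|l0 H0] := has_sum_increment HF (_ : 0 <= t + 1) e2; first lra.
have [d d0 Hd] := seq_gap l0 t; exists (Num.min d 1); first by rewrite lt_min d0 ltr01.
have m1 : Num.min d 1 <= d by rewrite ge_min lexx.
have m2 : Num.min d 1 <= 1 :> R by rewrite ge_min lexx orbT.
move=> s s1 s2; have sT : s <= t + 1 by lra.
have := H0 t s [::] t0 s1 sT isT; rewrite big_nil subr0 => H.
have C2 r : r \in l0 -> t < r <= s -> r \in [::].
  by move=> rl /andP[tr rs]; have [/(_ tr)] := Hd r rl; lra.
have : `|F s - F t| <= e / 2 by apply: H.
lra.
Qed.

Lemma sorted_sum_jumps_le (G : R -> R) (t c : R) (l : seq R) : cadlagR G ->
  (forall u v, 0 <= u -> u <= v -> G u <= G v) -> 0 <= c -> c <= t ->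
  path <%R c l -> (forall s, s \in l -> s <= t) -> \sum_(s <- l) jumpR G s <= G t - G c.
Proof.
move=> /cadlagRP[_ Gl] mono; elim: l c => [|s l IH] c c0 ct /=.
  by rewrite big_nil subr_ge0 mono.
move=> /andP[cs ps] sl; rewrite big_cons.
have st : s <= t by apply: sl; rewrite inE eqxx.
have s0 : 0 < s := le_lt_trans c0 cs.
have sl' r : r \in l -> r <= t by move=> rl; apply: sl; rewrite inE rl orbT.
have := IH s (ltW s0) st ps sl'.
suff : jumpR G s <= G s - G c by lra.
rewrite leNgt; apply/negP => H.
have [|d d0 Hd] := Gl s s0 (jumpR G s - (G s - G c)); first lra.
have d2 : 0 < d / 2 by lra.
have [u [u1 u2 u3]] := jump_point_near d2 cs.
have ud : s - d < u by lra.
have := Hd u ud u3; have := mono c u c0 (ltW u2); rewrite ltr_norml => ? /andP[? ?].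
lra.
Qed.

Lemma sum_jumps_le (G : R -> R) (t : R) (l : seq R) : cadlagR G ->
  (forall u v, 0 <= u -> u <= v -> G u <= G v) -> 0 <= t ->
  uniq l -> (forall s, s \in l -> `]0, t]%classic s) -> \sum_(s <- l) jumpR G s <= G t - G 0.
Proof.
move=> cG mono t0 ul sl.
have sl' s : s \in sort <=%R l -> 0 < s <= t by rewrite mem_sort => /sl; rewrite /= in_itv.
rewrite (perm_big (sort <=%R l)); last by rewrite perm_sym perm_sort.
apply: sorted_sum_jumps_le => //; last by move=> s /sl'/andP[].
rewrite path_min_sorted; first by rewrite sort_lt_sorted.
by apply/allP => s /sl'/andP[].
Qed.

(** Reads off regularity and jumps from the decomposition demanded by [is_qv]. *)
Lemma within_continuous_sum_cadlag (a Q Qc : R -> R) : {within `[0, +oo[, continuous Qc} ->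
  (forall t, 0 <= t -> has_sum a `]0, t] (Q t - Qc t)) ->
  cadlagR Q /\ forall t, 0 < t -> jumpR Q t = a t.
Proof.
move=> cQc /has_sum_cadlag[cD jD].
have QE : Q = (fun t => (Q t - Qc t) + Qc t) by apply/funext => t; rewrite subrK.
have cQ := continuous_cadlag cQc; rewrite QE; split; first exact: cadlagD.
by move=> t t0; rewrite (jumpD t0)// jD// continuous_jump0// addr0.
Qed.
End Sums.

(** * Positivity and jump decomposition of a pathwise limit *)

Section Decomposition.
Variable R : realType.

Lemma eN_cvg (u : nat -> R) (l : R) :
  (forall e, 0 < e -> exists N, forall n, (N <= n)%N -> `|u n - l| <= e) <-> u @ \oo --> l.
Proof.
split=> [H|/cvgrPdist_le H e /H[N _ HN]].
- by apply/cvgrPdist_le => e /H[N HN]; exists N => // n /= /HN; rewrite distrC.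
- by exists N => n Nn; rewrite distrC; apply: HN.
Qed.

Variables (k : nat -> nat) (tt : nat -> nat -> R).
Variables (d : nat) (x : 'I_d -> R -> R) (Y : R -> 'M[R]_d).
Hypothesis cx : forall i, cadlagR (x i).
Hypothesis cY : cadlag_mx Y.
Hypothesis HY : forall i j, qcov_limit k tt (x i) (x j) (fun t => Y t i j).

Lemma qcov_limit_cvg i j t : 0 <= t -> qcov k tt (x i) (x j) n t @[n --> \oo] --> Y t i j.
Proof. by move=> t0; apply/eN_cvg => e e0; have [_ /(_ t t0 e e0)] := HY i j. Qed.

(** The quadratic form of [Y] at [v] is the limit of the sums of squares of the scalar path [z],
    which increase with time. *)
Lemma qcov_limit_psd s t : 0 <= s -> s <= t -> psd (Y t - Y s).
Proof.
move=> s0 st v; pose z u := \sum_i v i 0 * x i u.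
have E n u : qcov k tt z z n u = \sum_i \sum_j v i 0 * v j 0 * qcov k tt (x i) (x j) n u.
  rewrite /qcov; under [RHS]eq_bigr => i _ do under eq_bigr => j _ do rewrite mulr_sumr.
  under [RHS]eq_bigr => i _ do rewrite exchange_big.
  rewrite exchange_big; apply: eq_bigr => l _.
  rewrite /incp /z -!sumrB mulr_suml; apply: eq_bigr => i _; rewrite mulr_sumr.
  by apply: eq_bigr => j _; ring.
have cv u : 0 <= u -> qcov k tt z z n u @[n --> \oo] --> \sum_i \sum_j v i 0 * v j 0 * Y u i j.
  move=> u0; under eq_cvg => n do rewrite E.
  apply: cvg_big => [|i _]; first exact: add_continuous.
  apply: cvg_big => [|j _]; first exact: add_continuous.
  by apply: cvgMr; exact: qcov_limit_cvg.
have -> : (v^T *m (Y t - Y s) *m v) 0 0 =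
    \sum_i \sum_j v i 0 * v j 0 * Y t i j - \sum_i \sum_j v i 0 * v j 0 * Y s i j.
  rewrite mxE [X in _ = X - _]exchange_big [X in _ = _ - X]exchange_big -sumrB; apply: eq_bigr => j _.
  rewrite mxE mulr_suml -sumrB; apply: eq_bigr => i _; rewrite !mxE; ring.
rewrite subr_ge0; apply: ler_cvg_to (cv s s0) (cv t (le_trans s0 st)) _.
by apply: nearW => n; apply: qcov_le.
Qed.

(** The continuous part is [Y] minus the sum of its jumps. Summability comes from the increasing
    functions [G i j], whose total increase bounds every finite sum of squared jumps of [X i j];
    mixed products follow by polarization. *)
Lemma qcov_limit_decomposition : exists Qc : R -> 'M[R]_d,
  (forall i j, {within `[0, +oo[, continuous (fun t => Qc t i j)}) /\
  (forall t, 0 <= t -> forall i j,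
     has_sum (fun s => jumpR (x i) s * jumpR (x j) s) `]0, t] (Y t i j - Qc t i j)).
Proof.
pose X i j u := x i u + x j u.
pose G i j u := Y u i i + Y u j j + 2 * Y u i j.
have cYZ i j : cadlagR (fun u => 2 * Y u i j) by apply: (cadlagZ 2 (cY i j)).
have cYD i j : cadlagR (fun u => Y u i i + Y u j j) by apply: cadlagD.
have cG i j : cadlagR (G i j) by apply: cadlagD.
have jY i j t : 0 < t -> jumpR (fun u => Y u i j) t = jumpR (x i) t * jumpR (x j) t.
  by have [H _] := HY i j; apply: H.
have jX i j t : 0 < t -> jumpR (X i j) t = jumpR (x i) t + jumpR (x j) t.
  by move=> t0; rewrite (jumpD t0).
have jG i j t : 0 < t -> jumpR (G i j) t = jumpR (X i j) t * jumpR (X i j) t.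
  move=> t0; rewrite (jumpD t0 (cYD _ _) (cYZ _ _)) (jumpD t0 (cY _ _) (cY _ _)).
  by rewrite (jumpZ _ t0 (cY _ _)) !jY// jX//; ring.
have cvG i j t : 0 <= t -> qcov k tt (X i j) (X i j) n t @[n --> \oo] --> G i j t.
  move=> t0; under eq_cvg => n do rewrite qcovDD.
  by apply: cvgD; [apply: cvgD|apply: cvgMr]; apply: qcov_limit_cvg.
have monoG i j u v : 0 <= u -> u <= v -> G i j u <= G i j v.
  move=> u0 uv; apply: ler_cvg_to (cvG i j u u0) (cvG i j v (le_trans u0 uv)) _.
  by apply: nearW => n; apply: qcov_le.
have sq i j t : exists v, 0 <= t ->
    has_sum (fun s => jumpR (X i j) s * jumpR (X i j) s) `]0, t] v.
  case: (leP 0 t) => t0; last by exists 0.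
  have [||v Hv] := @has_sum_bounded _ (fun s => jumpR (X i j) s * jumpR (X i j) s) `]0, t] (G i j t - G i j 0).
  - by move=> s _; rewrite -expr2 sqr_ge0.
  - move=> l ul sl; apply: le_trans (sum_jumps_le (cG i j) (monoG i j) t0 ul sl).
    rewrite big_seq [leRHS]big_seq; apply: ler_sum => s /sl.
    by rewrite /= in_itv/= => /andP[s0 _]; rewrite jG.
  by exists v.
have /choice[S HS] (a : 'I_d * 'I_d * R) : exists v, 0 <= a.2 ->
    has_sum (fun s => jumpR (X a.1.1 a.1.2) s * jumpR (X a.1.1 a.1.2) s) `]0, a.2] v.
  exact: sq.
(* [X i i] is twice [x i], so its squared jumps carry a factor 4, removed by [4^-1]. *)
pose F i j t := 2^-1 * (S (i, j, t) + (- 4^-1) * S (i, i, t) + (- 4^-1) * S (j, j, t)).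
have HF i j t : 0 <= t -> has_sum (fun s => jumpR (x i) s * jumpR (x j) s) `]0, t] (F i j t).
  move=> t0; have H := has_sumZ 2^-1 (has_sumD (has_sumD (HS (i, j, t) t0)
    (has_sumZ (- 4^-1) (HS (i, i, t) t0))) (has_sumZ (- 4^-1) (HS (j, j, t) t0))).
  apply: has_sum_ext H => s /=; rewrite in_itv/= => /andP[s0 _]; rewrite !jX//.
  by field.
exists (fun t => \matrix_(i, j) (Y t i j - F i j t)); split=> [i j|t t0 i j]; last first.
  by rewrite mxE opprB addrC subrK; apply: HF.
have [cF jF] := has_sum_cadlag (HF i j).
have -> : (fun t => (\matrix_(i, j) (Y t i j - F i j t)) i j) =
    (fun t => Y t i j + (- 1) * F i j t).
  by apply/funext => t; rewrite mxE mulN1r.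
have cN := cadlagZ (- 1) cF.
apply: cadlag_continuous; first exact: cadlagD.
move=> t t0; rewrite (jumpD t0 (cY i j) cN) (jumpZ _ t0 cF) jF// jY//; ring.
Qed.
End Decomposition.

(** * Convergence in probability along subsequences *)

Section UniformLimit.
Variable R : realType.

(** Write a point [y] near [t] as [lam n u]: then [h n y] is close to [Y u], while [u] and [y] are
    both near [t], where [Y] is continuous. Compactness of the time interval makes the threshold
    uniform. *)
Lemma J1_unif (h : nat -> R -> R) (Y : R -> R) : J1conv (@distR R) h Y -> cadlagR Y ->
  (forall t, 0 < t -> jumpR Y t = 0) ->
  forall T eps, 0 < eps -> exists N, forall n, (N <= n)%N ->
    forall t, 0 <= t <= T -> `|h n t - Y t| <= eps.
Proof.
move=> [lam [lamT HJ]] /cadlagRP[Yr Yl] J T eps e0.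
have e3 : 0 < eps / 3 by lra.
have cl t : 0 <= t -> exists2 d, 0 < d & forall u, 0 <= u -> `|u - t| < d -> `|Y u - Y t| < eps / 3.
  move=> t0; have [d1 d10 H1] := Yr t t0 _ e3.
  have [d2 d20 H2] : exists2 d, 0 < d & forall u, 0 <= u -> t - d < u -> u < t -> `|Y u - Y t| < eps / 3.
    move: t0; rewrite le_eqVlt => /predU1P[<-|t0]; first by exists 1 => // u; lra.
    have [d2 d20 H2] := Yl t t0 _ e3; exists d2 => // u _ u1 u2.
    by have := H2 u u1 u2; rewrite J// subr0.
  exists (Num.min d1 d2); first by rewrite lt_min d10.
  move=> u u0; rewrite lt_min !ltr_norml => /andP[/andP[a1 a2] /andP[a3 a4]].
  case: (leP t u) => tu; [have := H1 u tu _|have := H2 u u0 _ tu].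
  - by rewrite ltr_norml; apply; lra.
  - by rewrite ltr_norml; apply; lra.
have /compact_near_coveringP C := @segment_compact R 0 T.
suff [N _ HN] : \forall n \near \oo, `[0, T]%classic `<=` (fun t => 0 <= t -> `|h n t - Y t| <= eps).
  exists N => n Nn t /andP[t0 tT]; apply: (HN n) => //.
  by rewrite /= in_itv/= t0.
apply: C => t; rewrite /= in_itv/= => /andP[t0 tT].
have [d d0 Hd] := cl t t0.
have m0 : 0 < Num.min (eps / 3) (d / 2) by rewrite lt_min e3; lra.
have m1 : Num.min (eps / 3) (d / 2) <= eps / 3 by rewrite ge_min lexx.
have m2 : Num.min (eps / 3) (d / 2) <= d / 2 by rewrite ge_min lexx orbT.
have [N HN] := HJ (t + d) _ m0.
have d4 : 0 < d / 4 by lra.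
exists ((ball t (d / 4)), [set n | (N <= n)%N]).
  by split; [exact: nbhsx_ballx|exists N].
move=> [y n] [/= ty Nn] y0; move: ty; rewrite /ball/= ltr_norml => /andP[y1 y2].
have [_ _ lmono lsurj] := lamT n; have [u [u0 uy]] := lsurj y y0.
have ud : u <= t + d.
  rewrite leNgt; apply/negP => ud; have td0 : 0 <= t + d by lra.
  have := lmono _ _ td0 ud; have [|] := HN n Nn (t + d); first by rewrite td0 lexx.
  by rewrite uy ler_norml => /andP[? ?] _; lra.
have [|A B] := HN n Nn u; first by rewrite u0.
rewrite uy in A B; have {}A := le_trans A m2; have {}B := le_trans B m1.
move: A B; rewrite /distR !ler_norml => /andP[? ?] /andP[? ?].
have := Hd u u0; have := Hd y y0; rewrite !ltr_norml.
move=> /(_ ltac:(apply/andP; split; lra))/andP[? ?].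
move=> /(_ ltac:(apply/andP; split; lra))/andP[? ?].
by apply/andP; split; lra.
Qed.
End UniformLimit.

Section ConvergenceInProbability.
Variables (R : realType) (dsp : measure_display) (Om : measurableType dsp).
Variable P : probability Om R.

(** [E n eps] is the event that a deviation at rank [n] exceeds [eps]. Working with such events
    covers at once Skorokhod distances, differences at a fixed time and deviations over compacts. *)
Definition pr0 (E : nat -> R -> set Om) := forall eps eta : R, 0 < eps -> 0 < eta ->
  exists N, forall n, (N <= n)%N -> Plt P (E n eps) eta.

Definition as0 (E : nat -> R -> set Om) (w : Om) := forall eps : R, 0 < eps ->
  exists N, forall n, (N <= n)%N -> ~ E n eps w.

Lemma incr_choice (Q : nat -> nat -> Prop) : (forall j, exists N, forall n, (N <= n)%N -> Q j n) ->
  exists2 psi, {homo psi : m n / (m < n)%N} & forall j n, (psi j <= n)%N -> Q j n.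
Proof.
move=> /choice[N HN]; exists (fun j => \sum_(i < j.+1) (N i).+1)%N.
  by apply: homo_ltn => [y x z|i]; [exact: ltn_trans|rewrite [ltnRHS]big_ord_recr/=; lia].
by move=> j n; rewrite big_ord_recr/= => H; apply: HN; lia.
Qed.

(** Borel-Cantelli: the exceptional null set is the limit superior of the [B j]. *)
Lemma ae_eventually (B : nat -> set Om) : (forall j, measurable (B j)) ->
  (forall j, P (B j) <= (1 / (2 ^ j.+1)%:R)%:E)%E ->
  {ae P, forall w, exists J, forall j, (J <= j)%N -> ~ B j w}.
Proof.
move=> mB PB; exists (lim_sup_set B); split.
- by apply: bigcapT_measurable => n; apply: bigcup_measurable.
- apply: lim_sup_set_cvg0 => //; apply: (@le_lt_trans _ _ 1%E); last exact: ltry.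
  apply: le_trans (@epsilon_trick0 R 1 xpredT ler01).
  by apply: lee_nneseries => [j _ _|j _]; [exact: measure_ge0|exact: PB].
- move=> w /= nw n _; apply: contrapT => H; apply: nw; exists n => j nj Bj.
  by apply: H; exists j.
Qed.

Lemma pow2_small (eps : R) : 0 < eps -> exists J, forall j, (J <= j)%N -> 1 / (2 ^ j.+1)%:R <= eps.
Proof.
move=> e0; exists (Num.truncn eps^-1).+1 => j Jj.
have p0 : 0 < (2 ^ j.+1)%:R :> R by rewrite ltr0n expn_gt0.
rewrite mul1r invf_ple ?posrE//; apply: le_trans (ltW (truncnS_gt _)) _.
rewrite ler_nat; apply: leq_trans Jj _; apply: leq_trans (leqnSn j) _.
exact/ltnW/ltn_expl.
Qed.

(** One subsequence for countably many families: rank [j] treats the first [j.+1] of them at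
    accuracy [1 / 2 ^ j.+1], each with probability [1 / 2 ^ j.+1 / j.+1], so that their union
    remains summable in [j]. *)
Lemma pr0_subseq (E : nat -> nat -> R -> set Om) :
  (forall m n e, 0 < e -> measurable (E m n e)) ->
  (forall m n e e', e <= e' -> E m n e' `<=` E m n e) ->
  (forall m, pr0 (E m)) ->
  exists2 psi, {homo psi : m n / (m < n)%N} &
    {ae P, forall w, forall m, as0 (fun n => E m (psi n)) w}.
Proof.
move=> mE Emono HE.
have p0 j : 0 < 1 / (2 ^ j.+1)%:R :> R by rewrite divr_gt0// ltr0n expn_gt0.
have [|psi psi_incr Hpsi] := @incr_choice (fun j n => forall m : 'I_j.+1,
    Plt P (E m n (1 / (2 ^ j.+1)%:R)) (1 / (2 ^ j.+1)%:R / j.+1%:R)).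
  by move=> j; apply: fin_eventually => m; apply: HE => //; rewrite divr_gt0.
exists psi => //.
pose B j := \bigcup_(m in [set m | (m < j.+1)%N]) E m (psi j) (1 / (2 ^ j.+1)%:R).
have mB j : measurable (B j) by apply: bigcup_measurable => m _; apply: mE.
have PB j : (P (B j) <= (1 / (2 ^ j.+1)%:R)%:E)%E.
  rewrite /B bigcup_mkord; apply: le_trans (Boole_inequality P (fun i _ => mE i _ _ (p0 j))) _.
  apply: (@le_trans _ _ (\sum_(m < j.+1) (1 / (2 ^ j.+1)%:R / j.+1%:R)%:E)%E).
    by apply: lee_sum => m _; apply: ltW; apply: Hpsi.
  rewrite sumEFin sumr_const card_ord -[X in (X%:E <= _)%E]mulr_natr divfK ?pnatr_eq0//.
apply: filterS (ae_eventually mB PB) => w [J HJ] m eps e0.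
have [K HK] := pow2_small e0.
exists (maxn J (maxn K m)) => n; rewrite !geq_max => /and3P[Jn Kn mn] Ew.
by apply: (HJ n Jn); exists m => //; apply: Emono Ew; apply: HK.
Qed.

(** If it failed, some subsequence [phi] would keep probabilities at least [eta]. Along [phi \o psi]
    the limit superior of the events is null, but by continuity from above its probability is at
    least [eta]. *)
Lemma pr0_from_subseq (E : nat -> R -> set Om) :
  (forall n e, 0 < e -> measurable (E n e)) ->
  (forall phi, {homo phi : m n / (m < n)%N} -> exists2 psi, {homo psi : m n / (m < n)%N} &
     {ae P, forall w, as0 (fun n => E (phi (psi n))) w}) ->
  pr0 E.
Proof.
move=> mE H eps eta e0 eta0; apply: contrapT => nH.
have /choice[f Hf] N : exists n, (N <= n)%N /\ (eta%:E <= P (E n eps))%E.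
  apply: contrapT => K; apply: nH; exists N => n Nn; rewrite /Plt ltNge.
  by apply/negP => ?; apply: K; exists n.
pose phi := fix phi n := if n is n'.+1 then f (phi n').+1 else f 0%N.
have phi_incr : {homo phi : m n / (m < n)%N}.
  by apply: homo_ltn => [y x z|i]; [exact: ltn_trans|case: (Hf (phi i).+1)].
have phiP n : (eta%:E <= P (E (phi n) eps))%E.
  by case: n => [|n]; [case: (Hf 0%N)|case: (Hf (phi n).+1)].
have [psi psi_incr [Z [mZ PZ HZ]]] := H phi phi_incr.
pose F n := E (phi (psi n)) eps.
have mF n : measurable (F n) by apply: mE.
have PF : (P (lim_sup_set F) = 0)%E.
  apply: (subset_measure0 _ mZ _ PZ).
    by apply: bigcapT_measurable => n; apply: bigcup_measurable.
  move=> w Fw; apply: HZ => /= /(_ eps e0)[N HN].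
  by have [n /= Nn] := Fw N I; apply: HN.
have C : P (\bigcup_(j in [set j | (n <= j)%N]) F j) @[n --> \oo] --> P (lim_sup_set F).
  apply: lim_sup_set_cvg => //; apply: le_lt_trans (probability_le1 _ _) (ltry _).
  exact: bigcup_measurable.
rewrite PF in C.
suff : (eta%:E <= 0)%E by rewrite lee_fin leNgt eta0.
apply: (cvge_ge _ C); apply: nearW => n.
apply: le_trans (phiP (psi n)) _; apply: le_measure; rewrite ?inE//.
- exact: mE.
- exact: bigcup_measurable.
- by move=> w Ew; exists n => /=.
Qed.

Lemma cauchy_subseq (C : nat -> nat -> R -> set Om) :
  (forall m n e, measurable (C m n e)) ->
  (forall eps eta : R, 0 < eps -> 0 < eta -> exists N, forall m n,
     (N <= m)%N -> (N <= n)%N -> Plt P (C m n eps) eta) ->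
  exists2 psi, {homo psi : m n / (m < n)%N} &
    {ae P, forall w, exists J, forall j, (J <= j)%N ->
      ~ C (psi j.+1) (psi j) (1 / (2 ^ j.+1)%:R) w}.
Proof.
move=> mC HC.
have p0 j : 0 < 1 / (2 ^ j.+1)%:R :> R by rewrite divr_gt0// ltr0n expn_gt0.
have [|psi psi_incr Hpsi] := @incr_choice (fun j n => forall m, (n <= m)%N ->
    Plt P (C m n (1 / (2 ^ j.+1)%:R)) (1 / (2 ^ j.+1)%:R)).
  move=> j; have [N HN] := HC _ _ (p0 j) (p0 j); exists N => n Nn m nm.
  by apply: HN => //; apply: leq_trans nm.
exists psi => //; apply: ae_eventually => // j; apply: ltW; apply: Hpsi => //.
exact/ltnW/psi_incr.
Qed.
End ConvergenceInProbability.

(** * Measurability of the Skorokhod distance *)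

Section Discretization.
(** Finitely many real coordinates [co] with a constructor [mk] describe both matrices and reals, so
    one argument serves [delta] and [delta1]. *)
Variables (R : realType) (V : Type) (A : finType) (co : A -> V -> R) (mk : (A -> R) -> V).
Hypothesis mkK : forall a f, co a (mk f) = f a.
Variable dist : V -> V -> R.
Hypothesis distE : forall u v, dist u v = \sum_a `|co a u - co a v|.
Variable cad : (R -> V) -> Prop.
Hypothesis cadP : forall f, cad f <-> forall a, cadlagR (fun t => co a (f t)).

(* A path sampled at the points i / (m + 1), i <= (m + 1)^2, its values rounded down to
   multiples of 1 / (m + 1): such paths are coded by a countable type. *)
Definition grid_size (m : nat) : nat := (m.+1 * m.+1)%N.

Definition code (m : nat) (y : R -> V) : {ffun 'I_(grid_size m).+1 * A -> int} :=
  [ffun p : 'I_(grid_size m).+1 * A => Num.floor (m.+1%:R * co p.2 (y ((p.1 : nat)%:R / m.+1%:R)))].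

(** The minimum clamps the index, so a decoded path is constant beyond the last grid point. *)
Definition decode (m : nat) (c : {ffun 'I_(grid_size m).+1 * A -> int}) (t : R) : V :=
  mk (fun a => (c (inord (minn (Num.truncn (m.+1%:R * t)) (grid_size m)), a))%:~R / m.+1%:R).

Lemma trunc_cadlag (b : R) (f : nat -> R) : 0 < b -> cadlagR (fun t => f (Num.truncn (b * t))).
Proof.
move=> b0; apply: cadlag_from_llim => t t0.
- have bt0 : 0 <= b * t by rewrite mulr_ge0// ltW.
  have /andP[n1 n2] := truncn_itv bt0.
  move=> e e0; exists ((Num.truncn (b * t)).+1%:R / b - t).
    by rewrite subr_gt0 ltr_pdivlMr// mulrC.
  move=> s ts; rewrite addrCA subrr addr0 ltr_pdivlMr// mulrC => st.
  rewrite (@truncn_def _ (b * s) (Num.truncn (b * t))) ?subrr ?normr0//.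
  by rewrite st andbT; apply: le_trans n1 _; rewrite ler_pM2l.
- have bt0 : 0 < b * t by rewrite mulr_gt0.
  have bt0' := ltW bt0.
  have [||n nr /andP[n1 n2]] := @incr_upto_locateL R (Num.truncn (b * t)).+1 (fun i => i%:R) (b * t).
  + by [].
  + by have /andP[_ /ltW] := truncn_itv bt0'.
  exists (f n) => e e0; exists (t - n%:R / b).
    by rewrite subr_gt0 ltr_pdivrMr// mulrC.
  move=> s; rewrite opprB addrCA subrr addr0 ltr_pdivrMr// mulrC => ns st.
  rewrite (@truncn_def _ (b * s) n) ?subrr ?normr0//.
  by rewrite ltW//=; apply: lt_le_trans n2; rewrite ltr_pM2l.
Qed.

Lemma decode_cad m c : cad (@decode m c).
Proof.
apply/cadP => a; have m0 : 0 < m.+1%:R :> R by rewrite ltr0n.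
have := trunc_cadlag (fun i => (c (inord (minn i (grid_size m)), a))%:~R / m.+1%:R) m0.
by apply: cadlag_eq => t _; rewrite /decode mkK.
Qed.

Lemma floor_approx (b v : R) : 0 < b -> `|(Num.floor (b * v))%:~R / b - v| <= b^-1.
Proof.
move=> b0; have /andP[f1 f2] := floor_itv (b * v); rewrite intrD in f2.
have -> : (Num.floor (b * v))%:~R / b - v = ((Num.floor (b * v))%:~R - b * v) / b.
  by rewrite mulrBl mulrAC divff ?mul1r// gt_eqF.
rewrite normrM (gtr0_norm (_ : 0 < b^-1)) ?invr_gt0//.
rewrite ler_piMl ?invr_ge0 ?(ltW b0)// ler_norml; apply/andP; split; lra.
Qed.

(** Sampling delays a jump at [s l] to the next grid point [sg l], and the time change sends [s l]
    there. The grid point preceding [lam t] then lies in the same piece as [t], on which the path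
    oscillates little. *)
Lemma code_J1 (y : R -> V) : cad y -> J1conv dist (fun m => decode (code m y)) y.
Proof.
move=> /cadP cy; apply: J1convI => T eps e0.
have D0 : 0 < #|A|.+1%:R :> R by rewrite ltr0n.
(* Each of the [#|A|] coordinates contributes [c] for rounding and [c] for oscillation; the
   successor covers an empty [A]. *)
set c := eps / #|A|.+1%:R / 2; have c0 : 0 < c by rewrite !divr_gt0.
have [r [s [s0 si Ts so]]] := cadlag_partition T cy c0.
(* A grid step at most [g] keeps the rounded nodes distinct. *)
have [g g0 Hg] : exists2 g, 0 < g & forall l : 'I_r, s l + g <= s l.+1.
  apply: fin_small => [l d d' H d'0 d'd|l]; first by lra.
  by exists (s l.+1 - s l); rewrite ?subr_gt0 ?si//; lra.
have m0 : 0 < Num.min eps (Num.min c g) by rewrite !lt_min e0 c0.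
(* The last grid point is [m.+1], so the second condition makes the grid cover all the pieces. *)
have [N HN] : exists N, forall m, (N <= m)%N ->
    m.+1%:R^-1 <= Num.min eps (Num.min c g) /\ s r + 1 <= m.+1%:R.
  exists (maxn (Num.truncn (Num.min eps (Num.min c g))^-1).+1 (Num.truncn `|s r + 1|).+1).
  move=> m; rewrite geq_max => /andP[m1 m2]; split.
    rewrite invf_ple ?posrE//; apply: le_trans (ltW (truncnS_gt _)) _.
    by rewrite ler_nat; apply: leq_trans m1 _.
  apply: le_trans (ler_norm _) _; apply: le_trans (ltW (truncnS_gt _)) _.
  by rewrite ler_nat; apply: leq_trans m2 _.
exists N => m /HN[]; rewrite !le_min => /and3P[be bc bg] sm {N HN m0}.
have [b bE] : exists b, b = m.+1%:R :> R by exists m.+1%:R.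
rewrite -bE in be bc bg sm; have b0 : 0 < b by rewrite bE ltr0n.
pose sg l : R := (Num.ceil (b * s l))%:~R / b.
have sgb l : s l <= sg l /\ sg l < s l + b^-1.
  have /andP[u1 u2] := ceil_itv (b * s l); rewrite intrB in u1.
  split; first by rewrite /sg ler_pdivlMr// [s l * b]mulrC.
  rewrite /sg ltr_pdivrMr// mulrDl mulVf ?gt_eqF// [s l * b]mulrC; lra.
have sgi : incr_upto r sg.
  move=> l lr; have [_ A1] := sgb l; have [A2 _] := sgb l.+1.
  have A3 : s l + g <= s l.+1 := Hg (Ordinal lr).
  lra.
have sg0 : sg 0%N = 0 by rewrite /sg s0 mulr0 ceil0 mul0r.
have sgd l : (l <= r)%N -> `|sg l - s l| <= eps.
  by move=> _; have [A1 A2] := sgb l; rewrite ger0_norm; lra.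
have [lam [lamT lamE lamd]] := time_change_interp s0 sg0 si sgi sgd.
exists lam => // t /andP[t0 tT]; split; first exact: lamd.
have [||l lr /andP[t1 t2]] := @incr_upto_locate _ r s t; [by rewrite s0|lra|].
have [_ _ lmono _] := lamT; have sl0 : 0 <= s l by rewrite -s0; apply: (incr_upto_le si) => //; apply: ltnW.
have L1 : sg l <= lam t.
  rewrite -(lamE l (ltnW lr)); move: t1; rewrite le_eqVlt => /predU1P[->//|].
  by move=> /(lmono _ _ sl0)/ltW.
have L2 : lam t < sg l.+1 by rewrite -(lamE l.+1 lr); apply: lmono.
have u0 : 0 <= lam t by have [A1 _] := sgb l; lra.
have bu0 : 0 <= b * lam t by rewrite mulr_ge0// ltW.
have /andP[j1 j2] := truncn_itv bu0; set j := Num.truncn (b * lam t) in j1 j2.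
have p2 : j%:R / b < s l.+1.
  rewrite ltr_pdivrMr// mulrC; suff : (j%:Z < Num.ceil (b * s l.+1))%R by rewrite ceil_gt_int.
  rewrite -(ltr_int R); apply: (@le_lt_trans _ _ (b * lam t)); first exact: j1.
  by rewrite mulrC -ltr_pdivlMr.
have p1 : s l <= j%:R / b.
  have [A1 _] := sgb l; apply: le_trans A1 _; rewrite /sg ler_pM2r ?invr_gt0//.
  have A2 : (Num.ceil (b * s l))%:~R <= b * lam t.
    by rewrite [b * lam t]mulrC -ler_pdivrMr.
  suff : (Num.ceil (b * s l) <= j%:Z)%R by rewrite -(ler_int R).
  rewrite -ltzD1 -(ltr_int R) intrD; apply: le_lt_trans A2 _.
  by rewrite -natr1 in j2.
have jm : (j <= grid_size m)%N.
  rewrite -(ler_nat R) natrM -bE -ler_pdivrMr//; apply: le_trans (ltW p2) _.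
  by have := incr_upto_le si lr (leqnn r); lra.
rewrite distE; apply: (@le_trans _ _ (\sum_(a : A) (2 * c))).
  apply: ler_sum => a _; rewrite /decode mkK -bE -/j (minn_idPl jm) /code ffunE /=.
  rewrite inordK ?ltnS// -bE.
  have B1 := floor_approx (co a (y (j%:R / b))) b0.
  have B2 : `|co a (y (j%:R / b)) - co a (y t)| <= c by apply: (so l lr); rewrite ?p1 ?t1.
  move: B1 B2; rewrite !ler_norml => /andP[? ?] /andP[? ?].
  by apply/andP; split; lra.
have -> : 2 * c = eps / #|A|.+1%:R by rewrite mulrC /c divfK ?pnatr_eq0.
rewrite sumr_const -[_ *+ _]mulr_natr mulrAC ler_pdivrMr// ler_pM2l// ler_nat.
exact: leqnSn.
Qed.

Section Measurability.
Variables (dsp : measure_display) (Om : measurableType dsp).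
Variable meas : (Om -> V) -> Prop.
Hypothesis measP : forall Z, meas Z <-> forall a, measurable_fun setT (fun w => co a (Z w)).
Variable delta : (R -> V) -> (R -> V) -> R.
Hypothesis Hdelta : J1_metric cad dist delta.

Lemma measurable_countable_pred (C : countType) (K : Om -> C) (Q : C -> Prop) :
  (forall c, measurable [set w | K w = c]) -> measurable [set w | Q (K w)].
Proof.
move=> mK; have -> : [set w | Q (K w)] = \bigcup_c ([set w | K w = c] `&` [set _ | Q c]).
  by apply/seteqP; split=> [w Qw|w [c _ [/= <-]]//]; exists (K w).
apply: countable_bigcupT_measurable => // c; apply: measurableI => //.
have [Qc|nQ] := pselect (Q c).
- by rewrite (_ : [set _ | _] = setT)//; apply/seteqP; split.
- by rewrite (_ : [set _ | _] = set0)//; apply/seteqP; split.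
Qed.

Lemma code_measurable (Y : Om -> R -> V) m c : (forall t, meas (fun w => Y w t)) ->
  measurable [set w | code m (Y w) = c].
Proof.
move=> mY; set b : R := m.+1%:R; have b0 : 0 < b by rewrite ltr0n.
have -> : [set w | code m (Y w) = c] = \bigcap_(p in [set: 'I_(grid_size m).+1 * A])
    ([set: Om] `&` (fun w => co p.2 (Y w ((p.1 : nat)%:R / b))) @^-1`
       `[(c p)%:~R / b, (c p + 1)%:~R / b[%classic).
  apply/seteqP; split=> [w /= <- p _|w H].
  - split => //=; rewrite in_itv/= /code ffunE -/b ler_pdivrMr// ltr_pdivlMr//.
    by rewrite [_ * b]mulrC; apply: floor_itv.
  - apply/ffunP => p; rewrite /code ffunE -/b; apply: floor_def.
    have [_ /=] := H p I.
    by rewrite in_itv/= ler_pdivrMr// ltr_pdivlMr// [_ * b]mulrC.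
apply: fin_bigcap_measurable => [|p _]; first exact: finite_finset.
have /measP/(_ p.2) M := mY ((p.1 : nat)%:R / b).
exact: M.
Qed.

Lemma code_cvg y : cad y -> forall e, 0 < e -> exists N, forall m, (N <= m)%N ->
  delta (decode (code m y)) y < e.
Proof.
have [_ _ _ _ J] := Hdelta; move=> cy.
have [_ H] := J (fun m => decode (code m y)) y (fun m => decode_cad _) cy.
exact/H/code_J1.
Qed.

(** The distance is the pointwise limit of the distances [u m] between decoded paths. Each [u m] is
    a function of two codes, which take countably many values and have measurable level sets. *)
Lemma delta_measurable (Y Z : Om -> R -> V) eps : rv_D cad meas Y -> rv_D cad meas Z ->
  measurable [set w | eps < delta (Y w) (Z w)].
Proof.
move=> [cY mY] [cZ mZ]; have [_ sym tri _ _] := Hdelta.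
pose u m w := delta (decode (code m (Y w))) (decode (code m (Z w))).
have cvu w e : 0 < e -> exists N, forall m, (N <= m)%N -> `|u m w - delta (Y w) (Z w)| < e.
  move=> e0; have e2 : 0 < e / 2 by lra.
  have [N1 H1] := code_cvg (cY w) e2; have [N2 H2] := code_cvg (cZ w) e2.
  exists (maxn N1 N2) => m; rewrite geq_max => /andP[/H1 A1 /H2 A2]; rewrite /u.
  set y := decode (code m (Y w)) in A1 *; set z := decode (code m (Z w)) in A2 *.
  have cy : cad y := decode_cad _. have cz : cad z := decode_cad _.
  have B1 := tri y (Y w) z cy (cY w) cz; have B2 := tri (Y w) (Z w) z (cY w) (cZ w) cz.
  have B3 := tri (Y w) y (Z w) (cY w) cy (cZ w); have B4 := tri y z (Z w) cy cz (cZ w).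
  have S1 := sym (Y w) y (cY w) cy; have S2 := sym (Z w) z (cZ w) cz.
  by rewrite ltr_norml; apply/andP; split; lra.
have mu m a : measurable [set w | a < u m w].
  apply: (@measurable_countable_pred _ (fun w => (code m (Y w), code m (Z w)))
    (fun c => a < delta (decode c.1) (decode c.2))) => -[c c'].
  rewrite (_ : [set w | _] = [set w | code m (Y w) = c] `&` [set w | code m (Z w) = c']).
    by apply: measurableI; apply: code_measurable.
  by apply/seteqP; split=> w /= [-> ->].
(* A limit exceeds [eps] exactly when the sequence eventually exceeds [eps] by some fixed
   [k.+1%:R^-1]. *)
rewrite (_ : [set w | _] =
    \bigcup_k \bigcup_N \bigcap_(m in [set m | (N <= m)%N]) [set w | eps + k.+1%:R^-1 < u m w]).
  apply: bigcup_measurable => k _; apply: bigcup_measurable => N _.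
  exact: bigcap_measurableType.
apply/seteqP; split=> w /= H.
- have e0 : 0 < (delta (Y w) (Z w) - eps) / 2 by lra.
  have [N HN] := cvu w _ e0.
  exists (Num.truncn ((delta (Y w) (Z w) - eps) / 2)^-1) => //; exists N => // m /= /HN.
  have := truncnS_gt ((delta (Y w) (Z w) - eps) / 2)^-1.
  rewrite invf_plt ?posrE//; move: ((Num.truncn _).+1%:R^-1) => q B; rewrite ltr_norml => /andP[? ?]; lra.
- case: H => k _ [N _ HN]; have k0 : 0 < k.+1%:R^-1 :> R by rewrite invr_gt0.
  have [M HM] := cvu w _ k0; have := HM (maxn N M) (leq_maxr _ _).
  have := HN (maxn N M) (leq_maxl _ _) => /=.
  by move: (k.+1%:R^-1) => q B; rewrite ltr_norml => /andP[? ?]; lra.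
Qed.

End Measurability.
End Discretization.

(** * Completeness *)

Section Processes.
Variables (R : realType) (dsp : measure_display) (Om : measurableType dsp).
Variable P : probability Om R.

Lemma measurable_if0 (Z : set Om) (f : Om -> R) : measurable Z -> measurable_fun setT f ->
  measurable_fun setT (fun w => if w \in Z then 0 else f w).
Proof.
move=> mZ mf; apply: measurable_fun_if => //.
- by apply: (measurable_fun_bool true); rewrite setTI preimage_mem_true.
- exact: measurable_funTS.
Qed.

Lemma measurable_ltc (f : Om -> R) e : measurable_fun setT f -> measurable [set w | e < f w].
Proof.
move=> mf; have := mf measurableT `]e, +oo[%classic (measurable_itv _); rewrite setTI.
by congr measurable; apply/seteqP; split=> w /=; rewrite in_itv/= andbT.
Qed.

Lemma measurable_qcov k tt (x y : Om -> R -> R) n t :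
  (forall s, measurable_fun setT (fun w => x w s)) ->
  (forall s, measurable_fun setT (fun w => y w s)) ->
  measurable_fun setT (fun w => qcov k tt (x w) (y w) n t).
Proof.
move=> mx my; rewrite /qcov; under eq_fun => w do rewrite big_mkcond.
apply: measurable_sum => i; case: (tt n i <= t); last exact: measurable_cst.
exact: measurable_funM (measurable_funB (mx _) (mx _)) (measurable_funB (my _) (my _)).
Qed.

Lemma lt_half_summand (u v z e : R) : e < u -> u <= v + z -> v <= e / 2 -> e / 2 < z.
Proof. lra. Qed.

Lemma Plt_union (A B C : set Om) eta : measurable A -> measurable B -> measurable C ->
  A `<=` B `|` C -> Plt P B (eta / 2) -> Plt P C (eta / 2) -> Plt P A eta.
Proof.
move=> mA mB mC sub PB PC; rewrite /Plt [eta]splitr EFinD.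
apply: le_lt_trans (_ : _ <= P (B `|` C))%E _.
  by apply: le_measure; rewrite ?inE//; apply: measurableU.
by apply: le_lt_trans (measureU2 P mB mC) _; apply: lteD.
Qed.

Section Coordinates.
Variables (V : Type) (A : finType) (co : A -> V -> R) (mk : (A -> R) -> V).
Hypothesis mkK : forall a f, co a (mk f) = f a.
Variable dist : V -> V -> R.
Hypothesis distE : forall u v, dist u v = \sum_a `|co a u - co a v|.
Variable cad : (R -> V) -> Prop.
Hypothesis cadP : forall f, cad f <-> forall a, cadlagR (fun t => co a (f t)).
Variable meas : (Om -> V) -> Prop.
Hypothesis measP : forall Z, meas Z <-> forall a, measurable_fun setT (fun w => co a (Z w)).
Variable delta : (R -> V) -> (R -> V) -> R.
Hypothesis Hdelta : J1_metric cad dist delta.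
Variables (k : nat -> nat) (tt : nat -> nat -> R).
Hypothesis Hpart : fine_part k tt.
Variables x y : A -> Om -> R -> R.
Hypothesis cx : forall a w, cadlagR (x a w).
Hypothesis cy : forall a w, cadlagR (y a w).
Hypothesis mx : forall a t, measurable_fun setT (fun w => x a w t).
Hypothesis my : forall a t, measurable_fun setT (fun w => y a w t).
Variable q : nat -> Om -> R -> V.
Hypothesis qE : forall a n w t, co a (q n w t) = qcov k tt (x a w) (y a w) n t.

Lemma rv_qcov n : rv_D cad meas (q n).
Proof.
split=> [w|t].
- apply/cadP => a; apply: cadlag_eq (qcov_cadlag k tt (x a w) (y a w) n) => t _.
  by rewrite qE.
- apply/measP => a; under eq_fun => w do rewrite qE; exact: measurable_qcov.
Qed.

Lemma J1_coord (fs : nat -> R -> V) f a : J1conv dist fs f ->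
  J1conv (@distR R) (fun n t => co a (fs n t)) (fun t => co a (f t)).
Proof.
move=> [lam [lamT H]]; exists lam; split=> // T eps e0; have [N HN] := H T eps e0.
exists N => n Nn t tT; have [A1] := HN n Nn t tT; rewrite distE => A2; split=> //.
apply: le_trans A2; rewrite (bigD1 a)//= /distR lerDl.
by apply: sumr_ge0 => *; apply: normr_ge0.
Qed.

Lemma J1_path_limit phi w (f : R -> V) : {homo phi : m n / (m < n)%N} -> cad f ->
  J1conv dist (fun n => q (phi n) w) f ->
  forall a, qcov_limit (k \o phi) (tt \o phi) (x a w) (y a w) (fun t => co a (f t)).
Proof.
move=> phi_incr /cadP cf H a; apply: J1_qcov_limit => //; first exact: fine_part_subseq.
have := J1_coord a H.
by congr (J1conv _ _ _); apply/funext => n; apply/funext => t; rewrite qE.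
Qed.

Lemma conv_prob_subseq Q : rv_D cad meas Q -> conv_prob P delta q Q ->
  forall phi, {homo phi : m n / (m < n)%N} -> exists2 psi, {homo psi : m n / (m < n)%N} &
    {ae P, forall w, J1conv dist (fun n => q (phi (psi n)) w) (Q w)}.
Proof.
move=> rQ HQ phi phi_incr.
have [|m n e e' ee' w /= H|m eps eta e0 eta0|psi psi_incr Hpsi] := @pr0_subseq _ _ _ P
    (fun _ n e => [set w | e < delta (q (phi n) w) (Q w)]).
- by move=> _ n e e0; apply: (delta_measurable mkK distE cadP measP Hdelta) => //; apply: rv_qcov.
- exact: le_lt_trans H.
- have [N HN] := HQ eps eta e0 eta0; exists N => n Nn; apply: HN.
  exact: leq_trans Nn (subseq_ge phi_incr n).
exists psi => //; apply: filterS Hpsi => w /(_ 0%N) Hw.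
have [_ _ _ _ J] := Hdelta.
apply/(J (fun n => q (phi (psi n)) w)) => [n||eps e0]; first by case: (rv_qcov (phi (psi n))).
- by case: rQ.
- have e2 : 0 < eps / 2 by lra.
  have [N HN] := Hw _ e2; exists N => n /HN /= /negP; rewrite -leNgt; lra.
Qed.

Lemma conv_prob_from_subseq Q : rv_D cad meas Q ->
  (forall phi, {homo phi : m n / (m < n)%N} -> exists2 psi, {homo psi : m n / (m < n)%N} &
    {ae P, forall w, J1conv dist (fun n => q (phi (psi n)) w) (Q w)}) ->
  conv_prob P delta q Q.
Proof.
move=> rQ H; apply: (@pr0_from_subseq _ _ _ P (fun n e => [set w | e < delta (q n w) (Q w)])).
  by move=> n e _; apply: (delta_measurable mkK distE cadP measP Hdelta) => //; apply: rv_qcov.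
move=> phi phi_incr; have [psi psi_incr Hpsi] := H phi phi_incr; exists psi => //.
apply: filterS Hpsi => w; have [_ _ _ _ J] := Hdelta.
move/(J (fun n => q (phi (psi n)) w)) => Hw eps e0.
have [n||N HN] := Hw _ _ eps e0; first by case: (rv_qcov (phi (psi n))).
- by case: rQ.
- by exists N => n /HN /= ? ?; lra.
Qed.

Lemma converges_cauchy : converges_prob P cad meas delta q -> cauchy_prob P delta q.
Proof.
move=> [Q [rQ HQ]] eps eta e0 eta0.
have e2 : 0 < eps / 2 by lra. have eta2 : 0 < eta / 2 by lra.
have [N HN] := HQ _ _ e2 eta2; exists N => m n Nm Nn.
have mD Y Z e : rv_D cad meas Y -> rv_D cad meas Z -> measurable [set w | e < delta (Y w) (Z w)].
  exact: (delta_measurable mkK distE cadP measP Hdelta).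
apply: Plt_union (HN n Nn) (HN m Nm); try by apply: mD => //; apply: rv_qcov.
move=> w /= H; have [_ sym tri _ _] := Hdelta.
have [cn _] := rv_qcov n; have [cm _] := rv_qcov m; have [cQ _] := rQ.
have := tri _ _ _ (cn w) (cQ w) (cm w); rewrite (sym (Q w))//.
case: (ltP (eps / 2) (delta (q n w) (Q w))) => ? ?; [by left|right => /=].
lra.
Qed.

Lemma cauchy_geometric (fs : nat -> R -> V) J : (forall n, cad (fs n)) ->
  (forall j, (J <= j)%N -> delta (fs j.+1) (fs j) <= 1 / (2 ^ j.+1)%:R) ->
  exists f, cad f /\ forall eps : R, 0 < eps -> exists N, forall n, (N <= n)%N ->
    delta (fs n) f < eps.
Proof.
move=> cfs HJ; have [[ge0 eq0] sym tri compl _] := Hdelta.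
(* The telescoped form with the subtracted term is what the induction on [m] preserves. *)
have step n m : (J <= n)%N -> (n <= m)%N -> delta (fs m) (fs n) <= 1 / (2 ^ n)%:R - 1 / (2 ^ m)%:R.
  move=> Jn; elim: m => [|m IH]; first by rewrite leqn0 => /eqP->; rewrite subrr (eq0 _ _ _ _).2.
  rewrite leq_eqVlt => /predU1P[<-|nm]; first by rewrite subrr (eq0 _ _ _ _).2.
  have := tri _ _ _ (cfs m.+1) (cfs m) (cfs n); have := IH nm.
  have := HJ m (leq_trans Jn nm).
  have -> : 1 / (2 ^ m)%:R = 2 * (1 / (2 ^ m.+1)%:R) :> R.
    by rewrite expnS natrM invfM !mul1r mulrA divff ?mul1r// pnatr_eq0.
  move: (1 / (2 ^ n)%:R) (1 / (2 ^ m.+1)%:R) => u v; lra.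
apply: compl => // eps e0; have [K HK] : exists K, forall j, (K <= j)%N -> 1 / (2 ^ j)%:R < eps.
  have e2 : 0 < eps / 2 by lra.
  have [K HK] := pow2_small e2; exists K.+1 => -[//|j] Kj; have := HK j Kj; lra.
exists (maxn J K) => m n; rewrite !geq_max => /andP[Jm Km] /andP[Jn Kn].
have p0 j : 0 < 1 / (2 ^ j)%:R :> R by rewrite divr_gt0// ltr0n expn_gt0.
case: (leqP n m) => nm.
- apply: le_lt_trans (step _ _ Jn nm) _; apply: le_lt_trans (HK n Kn).
  by rewrite gerDl oppr_le0 ltW.
- rewrite sym//; apply: le_lt_trans (step _ _ Jm (ltnW nm)) _; apply: le_lt_trans (HK m Km).
  by rewrite gerDl oppr_le0 ltW.
Qed.

(** Completeness is applied path by path along a subsequence with summable consecutive distances.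
    The limit is measurable at each time because, for these sums, J1 convergence implies convergence
    at every time. *)
Lemma cauchy_converges : cauchy_prob P delta q -> converges_prob P cad meas delta q.
Proof.
move=> HC; have [[ge0 eq0] sym tri compl J] := Hdelta.
have mD Y Z e : rv_D cad meas Y -> rv_D cad meas Z -> measurable [set w | e < delta (Y w) (Z w)].
  exact: (delta_measurable mkK distE cadP measP Hdelta).
have cq n w : cad (q n w) by case: (rv_qcov n).
have [|eps eta e0 eta0|psi psi_incr [Z [mZ PZ HZ]]] := @cauchy_subseq _ _ _ P
    (fun m n e => [set w | e < delta (q m w) (q n w)]).
- by move=> m n e; apply: mD; apply: rv_qcov.
- by have [N HN] := HC eps eta e0 eta0; exists N => m n Nm Nn; apply: HN.
have /choice[f Hf] w : exists f, cad f /\ (w \notin Z -> forall eps : R, 0 < eps ->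
    exists N, forall n, (N <= n)%N -> delta (q (psi n) w) f < eps).
  case: (boolP (w \in Z)) => wZ; first by exists (q 0%N w).
  have [J0 HJ0] : exists J, forall j, (J <= j)%N ->
      ~ (1 / (2 ^ j.+1)%:R < delta (q (psi j.+1) w) (q (psi j) w)).
    by apply: contrapT => nw; move/negP: wZ; apply; rewrite inE; apply: HZ.
  have [j jJ|f [cf Hf]] := @cauchy_geometric (fun n => q (psi n) w) J0 (fun n => cq (psi n) w).
    by rewrite leNgt; apply/negP/HJ0.
  by exists f.
(* Negative times are reset as well: [rv_D] asks for measurability at every real [t], while [f w] is
   controlled only at nonnegative times. *)
pose Y w t := mk (fun a => if (w \in Z) || (t < 0) then 0 else co a (f w t)).
have cY w : cad (Y w).
  apply/cadP => a; case: (boolP (w \in Z)) => wZ.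
    by apply: cadlag_eq (cadlag_cst 0) => t _; rewrite /Y mkK wZ.
  have [/cadP/(_ a) cf _] := Hf w; apply: cadlag_eq cf => t t0.
  by rewrite /Y mkK (negbTE wZ) ltNge t0.
have dY w : w \notin Z -> forall eps : R, 0 < eps ->
    exists N, forall n, (N <= n)%N -> delta (q (psi n) w) (Y w) < eps.
  move=> wZ eps e0; have e2 : 0 < eps / 2 by lra.
  have [cf /(_ wZ _ e2)[N HN]] := Hf w.
  (* [f w] and [Y w] agree at nonnegative times, so the constant sequence [f w] tends to [Y w] in
     J1. *)
  have [|M HM] := (J (fun=> f w) (Y w) (fun=> cf) (cY w)).2 _ _ e2.
    exists (fun=> id); split=> [_|T e e1]; first exact: time_change_id.
    exists 0%N => _ _ t /andP[t0 _]; rewrite subrr normr0 ltW// distE big1 ?ltW// => a _.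
    by rewrite /Y mkK (negbTE wZ) ltNge t0 subrr normr0.
  exists N => n /HN; have := HM M (leqnn M).
  have := tri (q (psi n) w) (f w) (Y w) (cq _ _) cf (cY w); lra.
have mY t : meas (fun w => Y w t).
  apply/measP => a; rewrite /Y; under eq_fun => w do rewrite mkK.
  case: (ltP t 0) => t0.
    by under eq_fun => w do rewrite orbT; exact: measurable_cst.
  under eq_fun => w do rewrite orbF.
  apply: (@measurable_fun_cvg _ _ _ _
    (fun n w => if w \in Z then 0 else qcov k tt (x a w) (y a w) (psi n) t)).
    by move=> n; apply: measurable_if0 => //; apply: measurable_qcov.
  move=> w _ /=; case: (boolP (w \in Z)) => wZ; first exact: cvg_cst.
  have JY : J1conv dist (fun n => q (psi n) w) (Y w).
    by apply/(J _ _ (fun n => cq (psi n) w) (cY w)) => eps e0; apply: dY.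
  have [_ H] := J1_path_limit psi_incr (cY w) JY a.
  apply/eN_cvg => e e0; have [N HN] := H t t0 e e0; exists N => n /HN.
  by rewrite /Y mkK (negbTE wZ) ltNge t0.
have rY : rv_D cad meas Y by split.
exists Y; split=> // eps eta e0 eta0.
have e2 : 0 < eps / 2 by lra. have eta2 : 0 < eta / 2 by lra.
have [N HN] := HC _ _ e2 eta2.
pose E n e := [set w | e < delta (q (psi n) w) (Y w)].
have /(_ _ _ e2 eta2)[M HM] : pr0 P E.
  apply: pr0_from_subseq => [n e _|phi phi_incr].
    by apply: mD => //; apply: rv_qcov.
  exists id => //; exists Z; split=> // w /= nw; apply: contrapT => wZ; apply: nw => e e1.
  have wZ' : w \notin Z by apply/negP; rewrite inE.
  have [M HM] := dY w wZ' e e1; exists M => n Mn; apply/negP; rewrite -leNgt ltW//.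
  exact: HM (leq_trans Mn (subseq_ge phi_incr n)).
exists N => n Nn; set m := maxn N M.
have Nm : (N <= psi m)%N by apply: leq_trans (leq_maxl N M) (subseq_ge psi_incr m).
apply: Plt_union (HN (psi m) n Nm Nn) (HM m (leq_maxr _ _));
  try by apply: mD => //; apply: rv_qcov.
move=> w /=; have := tri _ _ _ (cq n w) (cq (psi m) w) (cY w); rewrite /E /=.
move=> uvz uE; case: (ltP (eps / 2) (delta (q n w) (q (psi m) w))) => vE; [by left|right].
exact: lt_half_summand uE uvz vE.
Qed.

Lemma converges_cauchyP : converges_prob P cad meas delta q <-> cauchy_prob P delta q.
Proof. by split; [exact: converges_cauchy|exact: cauchy_converges]. Qed.
End Coordinates.
End Processes.

(** * Quadratic variation of a process *)

Section QuadraticVariation.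
Variables (R : realType) (dsp : measure_display) (Om : measurableType dsp).
Variables (P : probability Om R) (d : nat) (k : nat -> nat) (tt : nat -> nat -> R).
Hypothesis Hpi : partition_seq k tt.
Variable delta : (R -> 'M[R]_d) -> (R -> 'M[R]_d) -> R.
Hypothesis Hdelta : J1_metric (@cadlag_mx R d d) (@dist_mx R d d) delta.
Variable delta1 : (R -> R) -> (R -> R) -> R.
Hypothesis Hdelta1 : J1_metric (@cadlagR R) (@distR R) delta1.
Variable X : Om -> R -> 'cV[R]_d.
Hypothesis HXm : forall t, meas_mx (fun w => X w t).
Hypothesis HXc : forall w, cadlag_mx (X w).

Let q := qv_seq X k tt.
Let x (i : 'I_d) (w : Om) (t : R) : R := X w t i 0.
Let Hpart := fine_partition Hpi.
Local Notation cad := (@cadlag_mx R d d).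
Local Notation meas := (@meas_mx R _ Om d d).
Local Notation meas1 := (@measR R _ Om).

Let co (a : 'I_d * 'I_d) (M : 'M[R]_d) := M a.1 a.2.
Let mk (f : 'I_d * 'I_d -> R) : 'M[R]_d := \matrix_(i, j) f (i, j).

Lemma mkK a f : co a (mk f) = f a.
Proof. by rewrite /co mxE -surjective_pairing. Qed.

Lemma dist_mxE (u v : 'M[R]_d) : dist_mx u v = \sum_a `|co a u - co a v|.
Proof. by rewrite /dist_mx pair_big. Qed.

Lemma cadlag_mxP (f : R -> 'M[R]_d) : cad f <-> forall a, cadlagR (fun t => co a (f t)).
Proof. by split=> [H a|H i j]; [apply: H|apply: (H (i, j))]. Qed.

Lemma meas_mxP (Z : Om -> 'M[R]_d) :
  meas Z <-> forall a, measurable_fun setT (fun w => co a (Z w)).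
Proof. by split=> [H a|H i j]; [apply: H|apply: (H (i, j))]. Qed.

Let cx i w : cadlagR (x i w). Proof. exact: HXc. Qed.
Let mx i t : measurable_fun setT (fun w => x i w t). Proof. exact: HXm. Qed.

Lemma qv_seqE n w t i j : q n w t i j = qcov k tt (x i w) (x j w) n t.
Proof.
rewrite /q /qv_seq summxE; apply: eq_bigr => l _.
by rewrite mxE big_ord1 /incp !mxE.
Qed.

Let qE a n w t : co a (q n w t) = qcov k tt (x a.1 w) (x a.2 w) n t.
Proof. exact: qv_seqE. Qed.

Lemma rv_q n : rv_D cad meas (q n).
Proof.
exact: (rv_qcov cadlag_mxP meas_mxP (fun a => mx a.1) (fun a => mx a.2) qE).
Qed.

Lemma mx_path_limit phi w f : {homo phi : m n / (m < n)%N} -> cad f ->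
  J1conv (@dist_mx R d d) (fun n => q (phi n) w) f ->
  forall i j, qcov_limit (k \o phi) (tt \o phi) (x i w) (x j w) (fun t => f t i j).
Proof.
move=> H1 H2 H3 i j.
exact: (J1_path_limit dist_mxE cadlag_mxP Hpart (fun a => cx a.1) (fun a => cx a.2) qE H1 H2 H3 (i, j)).
Qed.

Lemma mx_subseq Q : rv_D cad meas Q -> conv_prob P delta q Q ->
  forall phi, {homo phi : m n / (m < n)%N} -> exists2 psi, {homo psi : m n / (m < n)%N} &
    {ae P, forall w, J1conv (@dist_mx R d d) (fun n => q (phi (psi n)) w) (Q w)}.
Proof.
exact: (conv_prob_subseq mkK dist_mxE cadlag_mxP meas_mxP Hdelta
  (fun a => mx a.1) (fun a => mx a.2) qE).
Qed.

Lemma mx_from_subseq Q : rv_D cad meas Q ->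
  (forall phi, {homo phi : m n / (m < n)%N} -> exists2 psi, {homo psi : m n / (m < n)%N} &
    {ae P, forall w, J1conv (@dist_mx R d d) (fun n => q (phi (psi n)) w) (Q w)}) ->
  conv_prob P delta q Q.
Proof.
exact: (conv_prob_from_subseq mkK dist_mxE cadlag_mxP meas_mxP Hdelta
  (fun a => mx a.1) (fun a => mx a.2) qE).
Qed.

Lemma mx_converges_cauchy : converges_prob P cad meas delta q <-> cauchy_prob P delta q.
Proof.
exact: (converges_cauchyP P mkK dist_mxE cadlag_mxP meas_mxP Hdelta Hpart
  (fun a => cx a.1) (fun a => cx a.2) (fun a => mx a.1) (fun a => mx a.2) qE).
Qed.

(** * Single entries as real-valued processes *)

Let co1 (_ : unit) (v : R) := v.
Let mk1 (f : unit -> R) : R := f Datatypes.tt.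

Lemma mk1K a f : co1 a (mk1 f) = f a. Proof. by case: a. Qed.

Lemma distRE (u v : R) : distR u v = \sum_a `|co1 a u - co1 a v|.
Proof. by rewrite (big_pred1 Datatypes.tt)//; case. Qed.

Lemma cadlagR_unitP (f : R -> R) : cadlagR f <-> forall a, cadlagR (fun t => co1 a (f t)).
Proof. by split=> [//|/(_ Datatypes.tt)]. Qed.

Lemma measR_unitP (Z : Om -> R) : meas1 Z <-> forall a, measurable_fun setT (fun w => co1 a (Z w)).
Proof. by split=> [//|/(_ Datatypes.tt)]. Qed.

Section Component.
Variables i j : 'I_d.
Let qij n w t := q n w t i j.

Let qijE a n w t : co1 a (qij n w t) = qcov k tt (x i w) (x j w) n t.
Proof. exact: qv_seqE. Qed.

Lemma comp_path_limit phi w f : {homo phi : m n / (m < n)%N} -> cadlagR f ->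
  J1conv (@distR R) (fun n => qij (phi n) w) f ->
  qcov_limit (k \o phi) (tt \o phi) (x i w) (x j w) f.
Proof.
move=> H1 H2 H3.
exact: (J1_path_limit distRE cadlagR_unitP Hpart (fun=> cx i) (fun=> cx j) qijE H1 H2 H3 Datatypes.tt).
Qed.

Lemma comp_from_subseq Q : rv_D (@cadlagR R) meas1 Q ->
  (forall phi, {homo phi : m n / (m < n)%N} -> exists2 psi, {homo psi : m n / (m < n)%N} &
    {ae P, forall w, J1conv (@distR R) (fun n => qij (phi (psi n)) w) (Q w)}) ->
  conv_prob P delta1 qij Q.
Proof.
exact: (conv_prob_from_subseq mk1K distRE cadlagR_unitP measR_unitP Hdelta1
  (fun=> mx i) (fun=> mx j) qijE).
Qed.

Lemma comp_converges_cauchy :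
  converges_prob P (@cadlagR R) meas1 delta1 qij <-> cauchy_prob P delta1 qij.
Proof.
exact: (converges_cauchyP P mk1K distRE cadlagR_unitP measR_unitP Hdelta1 Hpart
  (fun=> cx i) (fun=> cx j) (fun=> mx i) (fun=> mx j) qijE).
Qed.

Lemma comp_rv n : rv_D (@cadlagR R) meas1 (qij n).
Proof. exact: (rv_qcov cadlagR_unitP measR_unitP (fun=> mx i) (fun=> mx j) qijE). Qed.

Lemma comp_measurable (Y Z : Om -> R -> R) e : rv_D (@cadlagR R) meas1 Y ->
  rv_D (@cadlagR R) meas1 Z -> measurable [set w | e < delta1 (Y w) (Z w)].
Proof. exact: (delta_measurable mk1K distRE cadlagR_unitP measR_unitP Hdelta1). Qed.
End Component.

Lemma rv_comp Q i j : rv_D cad meas Q -> rv_D (@cadlagR R) meas1 (fun w t => Q w t i j).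
Proof. by move=> [cQ mQ]; split=> [w|t]; [apply: cQ|apply: mQ]. Qed.

Lemma measurable_diff Q n t i j e : meas (fun w => Q w t) ->
  measurable [set w | e < `|q n w t i j - Q w t i j| ].
Proof.
move=> mQ; apply: measurable_ltc; apply: measurableT_comp => //.
apply: measurable_funB; last exact: mQ.
by have [_ mq] := rv_q n; apply: mq.
Qed.

Lemma conv_prob_is_qv Q : rv_D cad meas Q -> conv_prob P delta q Q -> is_qv P X k tt Q.
Proof.
move=> rQ HQ; have [cQ mQ] := rQ; split=> //.
- move=> t t0 i j.
  apply: (@pr0_from_subseq _ _ _ P (fun n e => [set w | e < `|q n w t i j - Q w t i j| ])).
    by move=> n e _; exact: measurable_diff (mQ _).
  move=> phi phi_incr; have [psi psi_incr Hpsi] := mx_subseq rQ HQ phi_incr.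
  exists psi => //; apply: filterS Hpsi => w Hw.
  have psi_phi : {homo phi \o psi : m n / (m < n)%N} by move=> m n mn /=; apply/phi_incr/psi_incr.
  have [_ H] := mx_path_limit psi_phi (cQ w) Hw i j.
  move=> e e0; have [N HN] := H t t0 e e0; exists N => n /HN A; apply/negP.
  by rewrite /= -leNgt qv_seqE.
- have [psi psi_incr Hpsi] := mx_subseq rQ HQ (phi := id) (fun m n mn => mn).
  apply: filterS Hpsi => w Hw.
  have H := mx_path_limit psi_incr (cQ w) Hw; split.
    by move=> s t s0 st; apply: qcov_limit_psd H _ _ s0 st.
  exact: (qcov_limit_decomposition (fun i => cx i w) (cQ w) H).
Qed.

(** [is_qv] makes the paths of [Q] càdlàg only almost surely, hence the separate [Y], an almost sure
    copy with càdlàg paths everywhere. *)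
Lemma is_qv_conv_prob Q Y : is_qv P X k tt Q -> rv_D cad meas Y ->
  {ae P, forall w, Y w = Q w} -> conv_prob P delta q Y.
Proof.
move=> [mQ HQ aeQ] rY aeY; have [cY mY] := rY.
apply: mx_from_subseq => // phi phi_incr.
(* The natural number [m] codes a rational time and an entry; invalid codes and negative times get
   the empty event. *)
pose E (m n : nat) (e : R) : set Om :=
  if (unpickle m : option (rat * ('I_d * 'I_d))) is Some (r, (i, j)) then
    if 0 <= r then [set w | e < `|q (phi n) w (ratr r) i j - Q w (ratr r) i j| ] else set0
  else set0.
have [m n e e0|m n e e' ee'|m|psi psi_incr Hpsi] := @pr0_subseq _ _ _ P E.
- rewrite /E; case: unpickle => // -[r [i j]]; case: ifP => // _.
  exact: measurable_diff (mQ _).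
- rewrite /E; case: unpickle => // -[r [i j]]; case: ifP => // _ w //=.
  exact: le_lt_trans.
- rewrite /E; case: (unpickle m : option (rat * ('I_d * 'I_d))) => [p|]; last first.
    by move=> eps eta e0 eta0; exists 0%N => n _; rewrite /Plt measure0 lte_fin.
  case: p => r [i j]; case: (boolP (0 <= r)) => r0; last first.
    by move=> eps eta e0 eta0; exists 0%N => n _; rewrite /Plt measure0 lte_fin.
  move=> eps eta e0 eta0; have rr0 : 0 <= ratr r :> R by rewrite ler0q.
  have [N HN] := HQ (ratr r) rr0 i j eps eta e0 eta0; exists N => n Nn.
  exact/HN/(leq_trans Nn)/subseq_ge.
exists psi => //; apply: filterS3 aeY aeQ Hpsi => w YQ [_ [Qc [cQc HQc]]] Hw.
have psi_phi : {homo phi \o psi : m n / (m < n)%N} by move=> m n mn /=; apply/phi_incr/psi_incr.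
have Hp := fine_part_subseq psi_phi Hpart.
have cj i j : cadlagR (fun t => Q w t i j) /\ forall t, 0 < t ->
    jumpR (fun t => Q w t i j) t = jumpR (x i w) t * jumpR (x j w) t.
  exact: (within_continuous_sum_cadlag (cQc i j) (fun t t0 => HQc t t0 i j)).
apply: (@qcov_mx_J1 _ _ _ Hp d (fun i => x i w)).
- by move=> n t i j; rewrite qv_seqE.
- by move=> i; apply: cx.
- exact: cY.
- by move=> i j t t0; rewrite YQ; have [_ ->] := cj i j.
- move=> i j r r0 e e0; have := Hw (pickle (r, (i, j))) e e0; rewrite /E pickleK r0.
  move=> [N HN]; exists N => n /HN /= /negP; rewrite -leNgt YQ qv_seqE.
  exact.
Qed.

Lemma finite_qv_converges : finite_qv P X k tt <-> converges_prob P cad meas delta q.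
Proof.
split=> [[Q HQ]|[Q [rQ HQ]]]; last by exists Q; apply: conv_prob_is_qv.
have [mQ _ [Z [mZ PZ HZ]]] := HQ.
pose Y w t : 'M[R]_d := if w \in Z then 0 else Q w t.
have rY : rv_D cad meas Y.
  split=> [w i j|t i j]; rewrite /Y; last first.
    have := measurable_if0 mZ (mQ t i j).
    by congr (measurable_fun _ _); apply/funext => w; case: ifP => _ //; rewrite mxE.
  case: (boolP (w \in Z)) => wZ.
    by apply: cadlag_eq (cadlag_cst 0) => t _; rewrite mxE.
  have [_ [Qc [cQc HQc]]] : (forall s t, 0 <= s -> s <= t -> psd (Q w t - Q w s)) /\
      exists Qc : R -> 'M[R]_d,
          (forall i j, {within `[0, +oo[, continuous (fun t => Qc t i j)}) /\
          (forall t, 0 <= t -> forall i j,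
             has_sum (fun s => jumpR (fun u => X w u i 0) s * jumpR (fun u => X w u j 0) s)
                     `]0, t] (Q w t i j - Qc t i j)).
    by apply: contrapT => nw; move/negP: wZ; apply; rewrite inE; apply: HZ.
  by have [] := within_continuous_sum_cadlag (cQc i j) (fun t t0 => HQc t t0 i j).
exists Y; split=> //; apply: is_qv_conv_prob HQ rY _.
exists Z; split=> // w /= nw; apply: contrapT => wZ; apply: nw.
by apply/funext => t; rewrite /Y ifF//; apply/negP; rewrite inE.
Qed.

(** For the converse, the time changes of the entries cannot be merged. Each entry yields only its
    values and jumps in the limit, and from these a common time change is rebuilt for the whole
    matrix. *)
Lemma converges_components : converges_prob P cad meas delta q <->
  forall i j, converges_prob P (@cadlagR R) meas1 delta1 (fun n w t => q n w t i j).
Proof.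
split=> [[Q [rQ HQ]] i j|H].
  exists (fun w t => Q w t i j); split; first exact: rv_comp.
  apply: comp_from_subseq => [|phi phi_incr]; first exact: rv_comp.
  have [psi psi_incr Hpsi] := mx_subseq rQ HQ phi_incr; exists psi => //.
  by apply: filterS Hpsi => w /(J1_coord dist_mxE (i, j)).
have /choice[Y HY] (a : 'I_d * 'I_d) : exists Y, rv_D (@cadlagR R) meas1 Y /\
    conv_prob P delta1 (fun n w t => q n w t a.1 a.2) Y by exact: H.
pose Q w t : 'M[R]_d := \matrix_(i, j) Y (i, j) w t.
have rQ : rv_D cad meas Q.
  split=> [w i j|t i j].
    by have [[cY _] _] := HY (i, j); apply: cadlag_eq (cY w) => t _; rewrite mxE.
  have [[_ mY] _] := HY (i, j); have := mY t.
  by congr (measurable_fun _ _); apply/funext => w; rewrite mxE.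
exists Q; split=> //; apply: mx_from_subseq => // phi phi_incr.
pose E (m n : nat) (e : R) : set Om :=
  if (unpickle m : option ('I_d * 'I_d)) is Some a then
    [set w | e < delta1 (fun t => q (phi n) w t a.1 a.2) (Y a w)] else set0.
have [m n e e0|m n e e' ee'|m|psi psi_incr Hpsi] := @pr0_subseq _ _ _ P E.
- rewrite /E; case: unpickle => // a; apply: (@comp_measurable (fun w t => q (phi n) w t a.1 a.2)).
    exact: comp_rv.
  by have [] := HY a.
- rewrite /E; case: unpickle => // a w //=.
  exact: le_lt_trans.
- rewrite /E; case: (unpickle m : option ('I_d * 'I_d)) => [a|] eps eta e0 eta0; last first.
    by exists 0%N => n _; rewrite /Plt measure0 lte_fin.
  have [_ /(_ eps eta e0 eta0)[N HN]] := HY a; exists N => n Nn.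
  exact/HN/(leq_trans Nn)/subseq_ge.
exists psi => //; apply: filterS Hpsi => w Hw.
have psi_phi : {homo phi \o psi : m n / (m < n)%N} by move=> m n mn /=; apply/phi_incr/psi_incr.
have Hp := fine_part_subseq psi_phi Hpart.
have HL i j : qcov_limit (k \o (phi \o psi)) (tt \o (phi \o psi)) (x i w) (x j w) (Y (i, j) w).
  have [[cY _] _] := HY (i, j); apply: comp_path_limit => //.
  have [_ _ _ _ J] := Hdelta1.
  apply/J => [n||eps e0]; [by have [] := comp_rv i j ((phi \o psi) n)|exact: cY|].
  have e2 : 0 < eps / 2 by lra.
  have := Hw (pickle (i, j)) _ e2; rewrite /E pickleK => -[N HN].
  exists N => n /HN /= /negP; rewrite -leNgt => A; apply: le_lt_trans A _.
  by rewrite ltr_pdivrMr// ltr_pMr// ltr1n.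
have QY i j : (fun t => Q w t i j) = Y (i, j) w by apply/funext => t; rewrite mxE.
apply: (@qcov_mx_J1 _ _ _ Hp d (fun i => x i w)).
- by move=> n t i j; rewrite qv_seqE.
- by move=> i; apply: cx.
- by case: rQ.
- by move=> i j t t0; rewrite QY; have [->] := HL i j.
- move=> i j r r0 e e0; have [_ L] := HL i j; have rr0 : 0 <= ratr r :> R by rewrite ler0q.
  have [N HN] := L _ rr0 e e0; exists N => n /HN.
  by rewrite -(QY i j).
Qed.

Lemma cauchy_components : cauchy_prob P delta q <->
  forall i j, cauchy_prob P delta1 (fun n w t => q n w t i j).
Proof.
split=> [/mx_converges_cauchy/converges_components H i j|H].
  exact/comp_converges_cauchy/H.
apply/mx_converges_cauchy/converges_components => i j.
exact/comp_converges_cauchy/H.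
Qed.

(** * Uniform convergence on compacts in probability *)

Lemma measurable_sup_gt (f : 'I_d -> 'I_d -> Om -> R -> R) (T e : R) : 0 < T ->
  (forall i j w, cadlagR (f i j w)) ->
  (forall i j t, measurable_fun setT (fun w => f i j w t)) ->
  measurable [set w | exists t, 0 <= t <= T /\ exists i j, e < `|f i j w t| ].
Proof.
move=> T0 cf mf.
(* Right continuity reduces [t < T] to rational times; clamping also reaches [T] itself, which may
   be irrational. *)
pose u (r : rat) : R := Num.min T (Num.max 0 (ratr r)).
have u01 r : 0 <= u r <= T.
  by rewrite /u le_min (ltW T0) le_max lexx /= ge_min lexx.
have -> : [set w | exists t, 0 <= t <= T /\ exists i j, e < `|f i j w t| ] =
    \bigcup_(p in [set: rat * ('I_d * 'I_d)]) [set w | e < `|f p.2.1 p.2.2 w (u p.1)| ].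
  apply/seteqP; split=> [w [t [/andP[t0 tT] [i [j He]]]]|w [[r [i j]] _ /= He]]; last first.
    by exists (u r); split=> //; exists i, j.
  move: tT; rewrite le_eqVlt => /predU1P[tT|tT].
    have [r /andP[r1 _]] : exists r : rat, T < ratr r < T + 1 by apply: rat_between; lra.
    exists (r, (i, j)) => //=; rewrite /u (max_idPr _) ?(min_idPl _) -?tT//; lra.
  have /cadlagRP[cr _] := cf i j w; have he : 0 < `|f i j w t| - e by lra.
  have [g g0 Hg] := cr t t0 _ he.
  have [|r /andP[r1 r2]] := @rat_between R t (Num.min T (t + g)).
    by rewrite lt_min tT; lra.
  move: r2; rewrite lt_min => /andP[r2 r3].
  exists (r, (i, j)) => //=; rewrite /u (max_idPr _) ?(min_idPr _); [|lra|lra].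
  have := Hg _ (ltW r1) r3; have := ler_distD (f i j w (ratr r)) 0 (f i j w t).
  by rewrite !sub0r !normrN; lra.
apply: countable_bigcupT_measurable => // p.
by apply: measurable_ltc; apply: measurableT_comp.
Qed.

Lemma ucp_measurable Q n T e : 0 < T -> rv_D cad meas Q ->
  measurable [set w | exists t, 0 <= t <= T /\ exists i j, e < `|q n w t i j - Q w t i j| ].
Proof.
move=> T0 [cQ mQ]; have [cq mq] := rv_q n.
apply: (measurable_sup_gt (f := fun i j w t => q n w t i j - Q w t i j)) => //.
- move=> i j w; have := cadlagD (cq w i j) (cadlagZ (- 1) (cQ w i j)).
  by apply: cadlag_eq => t _; rewrite mulN1r.
- by move=> i j t; apply: measurable_funB; [apply: mq|apply: mQ].
Qed.

(** The countable family of events is indexed by the horizons [m.+1], so one subsequence serves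
    every [T]. *)
Lemma ucp_uniform_subseq Q : rv_D cad meas Q -> ucp P q Q ->
  forall phi, {homo phi : m n / (m < n)%N} -> exists2 psi, {homo psi : m n / (m < n)%N} &
    {ae P, forall w, forall T eps, 0 < eps -> exists N, forall n, (N <= n)%N ->
      forall t, 0 <= t <= T -> forall i j, `|q (phi (psi n)) w t i j - Q w t i j| <= eps}.
Proof.
move=> rQ HQ phi phi_incr.
have [m n e e0|m n e e' ee' w [t [tT [i [j H]]]]|m eps eta e0 eta0|psi psi_incr Hpsi] :=
  @pr0_subseq _ _ _ P (fun m n e => [set w | exists t, 0 <= t <= m.+1%:R /\
    exists i j, e < `|q (phi n) w t i j - Q w t i j| ]).
- exact: ucp_measurable.
- by exists t; split=> //; exists i, j; apply: le_lt_trans H.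
- have [|N HN] := HQ m.+1%:R eps eta _ e0 eta0; first by rewrite ltr0n.
  by exists N => n Nn; apply/HN/(leq_trans Nn)/subseq_ge.
exists psi => //; apply: filterS Hpsi => w Hw T eps e0.
have [N HN] := Hw (Num.truncn `|T|) _ e0; exists N => n Nn t /andP[t0 tT] i j.
rewrite leNgt; apply/negP => H; apply: (HN n Nn); exists t; split; last by exists i, j.
rewrite t0; apply: le_trans tT _; apply: le_trans (ler_norm _) _.
exact/ltW/truncnS_gt.
Qed.

(** Uniform convergence is J1 convergence with identity time changes. It annihilates the jump
    products, and on the diagonal these are the squares of the jumps of [X]. *)
Lemma ucp_is_qv Q : rv_D cad meas Q -> ucp P q Q -> as_continuous P X /\ is_qv P X k tt Q.
Proof.
move=> rQ HQ; have [cQ mQ] := rQ; split.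
  have [psi psi_incr Hpsi] := ucp_uniform_subseq rQ HQ (phi := id) (fun m n mn => mn).
  apply: filterS Hpsi => w Hw i; apply: (cadlag_continuous (cx i w)) => t t0.
  have Hp := fine_part_subseq psi_incr Hpart.
  have H : forall T eps, 0 < eps -> exists N, forall n, (N <= n)%N -> forall t, 0 <= t <= T ->
      `|qcov (k \o psi) (tt \o psi) (x i w) (x i w) n t - Q w t i i| <= eps.
    move=> T eps e0; have [N HN] := Hw T eps e0; exists N => n Nn s sT.
    by have := HN n Nn s sT i i; rewrite qv_seqE.
  have := unif_qcov_nojump Hp (cx i w) (cx i w) (cQ w i i) H t0.
  by move/eqP; rewrite mulf_eq0 orbb => /eqP.
apply: conv_prob_is_qv => //; apply: mx_from_subseq => // phi phi_incr.
have [psi psi_incr Hpsi] := ucp_uniform_subseq rQ HQ phi_incr; exists psi => //.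
apply: filterS Hpsi => w Hw; exists (fun=> id); split=> [_|T eps e0]; first exact: time_change_id.
have D0 : 0 < eps / (d * d).+1%:R by rewrite divr_gt0.
have [N HN] := Hw T _ D0; exists N => n Nn t tT; split; first by rewrite subrr normr0 ltW.
apply: (@le_trans _ _ (\sum_(i < d) \sum_(j < d) (eps / (d * d).+1%:R))).
  by apply: ler_sum => i _; apply: ler_sum => j _; apply: HN.
rewrite !sumr_const card_ord -mulrnA -[leLHS]mulr_natr -mulrA ler_piMr ?(ltW e0)//.
by rewrite mulrC ler_pdivrMr// mul1r ler_nat.
Qed.

(** Continuity of [X] annihilates the jumps of the limit, and J1 convergence to a continuous limit
    is locally uniform. *)
Lemma is_qv_ucp Q : rv_D cad meas Q -> as_continuous P X -> is_qv P X k tt Q -> ucp P q Q.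
Proof.
move=> rQ HX HQ T eps eta T0 e0 eta0; have [cQ mQ] := rQ.
have CQ : conv_prob P delta q Q.
  by apply: is_qv_conv_prob HQ rQ _; apply: aeW.
apply: (@pr0_from_subseq _ _ _ P (fun n e => [set w | exists t, 0 <= t <= T /\
    exists i j, e < `|q n w t i j - Q w t i j| ])) e0 eta0 => [n e _|phi phi_incr].
  exact: ucp_measurable.
have [psi psi_incr Hpsi] := mx_subseq rQ CQ phi_incr; exists psi => //.
apply: filterS2 HX Hpsi => w Xw Hw e e0.
have psi_phi : {homo phi \o psi : m n / (m < n)%N} by move=> m n mn /=; apply/phi_incr/psi_incr.
have HL := mx_path_limit psi_phi (cQ w) Hw.
have [|N HN] := @fin_eventually ('I_d * 'I_d)%type (fun a n => forall t, 0 <= t <= T ->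
    `|q (phi (psi n)) w t a.1 a.2 - Q w t a.1 a.2| <= e).
  move=> [i j]; apply: (J1_unif (J1_coord dist_mxE (i, j) Hw) (cQ w i j) _ _ e0) => t t0.
  have [-> //] := HL i j; rewrite [jumpR (x i w) t]continuous_jump0 ?mul0r//.
  exact: Xw.
exists N => n Nn [t [tT [i [j]]]]; rewrite ltNge; apply/negP/negPn.
exact: (HN n Nn (i, j)).
Qed.
End QuadraticVariation.

Unset Implicit Arguments.

Theorem theorem4p4 (R : realType) (dsp : measure_display) (Om : measurableType dsp)
  (P : probability Om R) (d : nat)
  (k : nat -> nat) (tt : nat -> nat -> R) (Hpi : partition_seq k tt)
  (delta : (R -> 'M[R]_d) -> (R -> 'M[R]_d) -> R)
  (Hdelta : J1_metric (@cadlag_mx R d d) (@dist_mx R d d) delta)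
  (delta1 : (R -> R) -> (R -> R) -> R)
  (Hdelta1 : J1_metric (@cadlagR R) (@distR R) delta1)
  (X : Om -> R -> 'cV[R]_d)
  (HXm : forall t, meas_mx (fun w => X w t))
  (HXc : forall w, cadlag_mx (X w)) :
  let q := qv_seq X k tt in
  (* (i) <-> (ii) <-> (iii) *)
  [/\ (finite_qv P X k tt <-> converges_prob P (@cadlag_mx R d d) (@meas_mx R _ Om d d) delta q),
      (converges_prob P (@cadlag_mx R d d) (@meas_mx R _ Om d d) delta q
         <-> cauchy_prob P delta q),
  (* (iv) *)
      (forall Q, rv_D (@cadlag_mx R d d) (@meas_mx R _ Om d d) Q ->
         conv_prob P delta q Q -> is_qv P X k tt Q),
  (* (v) *)
      (forall Q, rv_D (@cadlag_mx R d d) (@meas_mx R _ Om d d) Q ->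
         (ucp P q Q <-> (as_continuous P X /\ is_qv P X k tt Q))) &
  (* (vi) *)
      (converges_prob P (@cadlag_mx R d d) (@meas_mx R _ Om d d) delta q
         <-> forall i j, converges_prob P (@cadlagR R) (@measR R _ Om) delta1
                           (fun n w t => q n w t i j)) /\
      (cauchy_prob P delta q
         <-> forall i j, cauchy_prob P delta1 (fun n w t => q n w t i j))].
Proof.
move=> q; split.
- exact: (finite_qv_converges P Hpi Hdelta HXm HXc).
- exact: (mx_converges_cauchy P Hpi Hdelta HXm HXc).
- exact: (conv_prob_is_qv Hpi Hdelta HXm HXc).
- move=> Q rQ; split=> [|[HX HQ]]; first exact: (ucp_is_qv Hpi Hdelta HXm HXc rQ).
  exact: (is_qv_ucp Hpi Hdelta HXm HXc rQ HX HQ).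
- split; first exact: (converges_components P Hpi Hdelta Hdelta1 HXm HXc).
  exact: (cauchy_components P Hpi Hdelta Hdelta1 HXm HXc).
Qed.
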